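(* Let $F$ be an algebraically closed field of characteristic $2$, let $C=\mathrm{CD}(Q,\alpha)$ be a Hurwitz superalgebra over $F$, where $Q$ is a Hurwitz algebra of dimension $2$ or $4$ and $0\neq\alpha\in F$, let $G$ be an abelian group, and let $\Gamma$ be a $G$-grading on the superalgebra $C$. If $\dim C=4$, there is some $g\in G$ such that $\Gamma$ is isomorphic to $\Gamma(G,g)$; if $\dim C=8$, there is some triple $\gamma=(g_1,g_2,g_3)$ of elements of $G$ with $g_1+g_2+g_3=0$ such that $\Gamma$ is isomorphic to $\Gamma(G,\gamma)$. Moreover: $\bullet$ (for $\dim C=4$) $\Gamma(G,g)\cong\Gamma(G,h)$ if and only if $g=h$ or $g=-h$; $\bullet$ (for $\dim C=8$) $\Gamma(G,\gamma)\cong\Gamma(G,\gamma')$ if and only if $\gamma\sim\gamma'$.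
   Context: Gradings. A grading by an abelian group $G$ (written additively) on an algebra $\mathcal A$ is a decomposition $\mathcal A=\bigoplus_{g\in G}\mathcal A^g$ into subspaces with $\mathcal A^g\mathcal A^h\subseteq\mathcal A^{g+h}$. A superalgebra is a $\mathbb{Z}_2$-graded algebra $\mathcal A=\mathcal A_{\bar0}\oplus\mathcal A_{\bar1}$ (the main grading). A grading on the superalgebra $\mathcal A$ is a group grading on the algebra $\mathcal A$ such that $\mathcal A^g=(\mathcal A^g\cap\mathcal A_{\bar0})\oplus(\mathcal A^g\cap\mathcal A_{\bar1})$ for all $g$. Two $G$-gradings are isomorphic ($\cong$) if there is an isomorphism of superalgebras (preserving the main grading) which, for every $g\in G$, maps the component of degree $g$ of the first onto the component of degree $g$ of the second. Hurwitz algebras. A Hurwitz algebra is a unital algebra over $F$ with a regular multiplicative quadratic form $q$ (the norm); its polar form is also denoted $q$, and $\bar x=q(x,1)1-x$. Given a Hurwitz algebra $Q$ and $0\ne\alpha\in F$, $\mathrm{CD}(Q,\alpha)=Q\oplus Qu$ has multiplication $(a+bu)(c+du)=(ac-\alpha\bar d b)+(da+b\bar c)u$ for $a,b,c,d\in Q$; it is a Hurwitz algebra with norm $q(a+bu)=q(a)+\alpha q(b)$ and a superalgebra with even part $C_{\bar0}=Q$ and odd part $C_{\bar1}=Qu$. Canonical basis of a split Cayley ($8$-dimensional Hurwitz) algebra: a basis $\{e_1,e_2,u_1,u_2,u_3,v_1,v_2,v_3\}$ with (indices mod $3$) $e_i^2=e_i$, $e_1e_2=e_2e_1=0$, $e_1u_i=u_i=u_ie_2$,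 $e_2v_i=v_i=v_ie_1$, $e_2u_i=u_ie_1=e_1v_i=v_ie_2=0$, $u_iu_{i+1}=v_{i+2}=-u_{i+1}u_i$, $v_iv_{i+1}=u_{i+2}=-v_{i+1}v_i$, $u_i^2=v_i^2=0$, $u_iv_j=-\delta_{ij}e_1$, $v_iu_j=-\delta_{ij}e_2$. A canonical basis of the split quaternion ($4$-dimensional Hurwitz) algebra is a basis $\{e_1,e_2,u_1,v_1\}$ with the same multiplication rules. The gradings. If $\dim C=4$, take a canonical basis $\{e_1,e_2,u_1,v_1\}$ of $C$ with $C_{\bar0}=\mathrm{span}\{e_1,e_2\}$, $C_{\bar1}=\mathrm{span}\{u_1,v_1\}$; for $g\in G$, $\Gamma(G,g)$ is the $G$-grading with $\deg(e_1)=\deg(e_2)=0$, $\deg(u_1)=g$, $\deg(v_1)=-g$. If $\dim C=8$, take a canonical basis of $C$ with $C_{\bar0}=\mathrm{span}\{e_1,e_2,u_3,v_3\}$, $C_{\bar1}=\mathrm{span}\{u_1,u_2,v_1,v_2\}$; for a triple $\gamma=(g_1,g_2,g_3)$ in $G$ with $g_1+g_2+g_3=0$, $\Gamma(G,\gamma)$ is the $G$-grading with $\deg(e_1)=\deg(e_2)=0$, $\deg(u_i)=g_i$, $\deg(v_i)=-g_i$ for $i=1,2,3$. Up to isomorphism these do not depend on the chosen canonical basis. For such triples, $\gamma\sim\gamma'$ means that there are $\sigma\in\mathrm{Sym}(2)$ and $\varepsilon\in\{\pm1\}$ with $g_3'=\varepsilon g_3$ and $g_i'=\varepsilon g_{\sigma(i)}$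 for $i=1,2$. *)

(* Defs.v *)
From HB Require Import structures.
From mathcomp Require Import all_boot all_algebra perm.

Set Implicit Arguments.
Unset Strict Implicit.
Unset Printing Implicit Defensive.

Import GRing.Theory.
Local Open Scope ring_scope.

Section Algebras.
Variable F : fieldType.

(* Finite-dimensional, not necessarily associative, commutative or unital. *)
Record algebra := Algebra {
  alg_sort :> vectType F;
  amul : alg_sort -> alg_sort -> alg_sort;
  amul_linear_r : forall x, linear (amul x);
  amul_linear_l : forall y, linear (amul^~ y) }.

(* [G] may be infinite, so the direct sum decomposition is stated with finitely
   supported families. *)
Record is_grading (A : algebra) (G : zmodType) (Gam : G -> {vspace A}) :
    Prop := IsGrading {
  grading_span : forall x : A, exists (s : seq G) (f : G -> A),
    (forall g, f g \in Gam g) /\ x = \sum_(g <- s) f g;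
  grading_free : forall (s : seq G) (f : G -> A), uniq s ->
    (forall g, f g \in Gam g) -> \sum_(g <- s) f g = 0 ->
    forall g, g \in s -> f g = 0;
  grading_mul : forall (g h : G) (x y : A),
    x \in Gam g -> y \in Gam h -> amul x y \in Gam (g + h) }.

Record superalgebra := Superalgebra {
  salg :> algebra;
  main_grading : 'Z_2 -> {vspace salg};
  main_gradingP : is_grading main_grading }.

Definition even_part (A : superalgebra) : {vspace A} := main_grading A 0.
Definition odd_part (A : superalgebra) : {vspace A} := main_grading A 1.

Definition is_super_grading (A : superalgebra) (G : zmodType)
    (Gam : G -> {vspace A}) : Prop :=
  is_grading Gam /\
  forall g, directv ((Gam g :&: even_part A) + (Gam g :&: odd_part A)) /\
    Gam g = ((Gam g :&: even_part A) + (Gam g :&: odd_part A))%VS.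

Record is_superalgebra_iso (A B : superalgebra) (f : 'Hom(A, B)) : Prop :=
    IsSuperalgebraIso {
  siso_inj : lker f = 0%VS;
  siso_surj : limg f = fullv;
  siso_mul : forall x y : A, f (amul x y) = amul (f x) (f y);
  siso_even : (f @: even_part A)%VS = even_part B;
  siso_odd : (f @: odd_part A)%VS = odd_part B }.

Definition grading_iso (A B : superalgebra) (G : zmodType)
    (Gam : G -> {vspace A}) (Del : G -> {vspace B}) : Prop :=
  exists f : 'Hom(A, B),
    is_superalgebra_iso f /\ forall g, (f @: Gam g)%VS = Del g.

Definition polar (V : lmodType F) (q : V -> F) (x y : V) : F :=
  q (x + y) - q x - q y.

Definition quadratic_form (V : lmodType F) (q : V -> F) : Prop :=
  (forall (a : F) (x : V), q (a *: x) = a ^+ 2 * q x) /\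
  (forall y : V, scalar (polar q ^~ y)) /\ (forall x : V, scalar (polar q x)).

(* The radical of the polar form may be nonzero, but then [q] is anisotropic on
   it; this is the usual notion that also makes sense in characteristic 2. *)
Definition regular_form (V : lmodType F) (q : V -> F) : Prop :=
  forall x : V, (forall y, polar q x y = 0) -> q x = 0 -> x = 0.

Record hurwitz := Hurwitz {
  halg :> algebra;
  hone : halg;
  hnorm : halg -> F;
  hone_l : forall x : halg, amul hone x = x;
  hone_r : forall x : halg, amul x hone = x;
  hnorm_quadratic : quadratic_form hnorm;
  hnorm_regular : regular_form hnorm;
  hnorm_mul : forall x y : halg, hnorm (amul x y) = hnorm x * hnorm y }.

Definition hconj (Q : hurwitz) (x : Q) : Q :=
  polar (@hnorm Q) x (hone Q) *: hone Q - x.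

Lemma hconj_linear (Q : hurwitz) : linear (@hconj Q).
Proof.
move=> a x y; rewrite /hconj.
have [_ [-> _]] := hnorm_quadratic Q.
by rewrite (scalerBr a) scalerDl scalerA opprD addrACA.
Qed.

Section CayleyDickson.
Variables (Q : hurwitz) (alpha : F).

(* The pair (a, b) stands for a + b u. *)
Definition CD_mul (x y : Q * Q) : Q * Q :=
  (amul x.1 y.1 - alpha *: amul (hconj y.2) x.2,
   amul y.2 x.1 + amul x.2 (hconj y.1)).

Lemma CD_mul_linear_r (x : Q * Q) : linear (CD_mul x).
Proof.
move=> a y z.
suff [E1 E2] : (CD_mul x (a *: y + z)).1
                 = a *: (CD_mul x y).1 + (CD_mul x z).1 /\
               (CD_mul x (a *: y + z)).2
                 = a *: (CD_mul x y).2 + (CD_mul x z).2.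
  by rewrite [LHS]surjective_pairing E1 E2.
rewrite /= !hconj_linear; split; rewrite amul_linear_r amul_linear_l.
  by rewrite (scalerBr a) (scalerDr alpha) !scalerA (mulrC a) opprD addrACA.
by rewrite scalerDr addrACA.
Qed.

Lemma CD_mul_linear_l (y : Q * Q) : linear (CD_mul^~ y).
Proof.
move=> a x z.
suff [E1 E2] : (CD_mul (a *: x + z) y).1
                 = a *: (CD_mul x y).1 + (CD_mul z y).1 /\
               (CD_mul (a *: x + z) y).2
                 = a *: (CD_mul x y).2 + (CD_mul z y).2.
  by rewrite [LHS]surjective_pairing E1 E2.
rewrite /=; split; rewrite amul_linear_r amul_linear_l.
  by rewrite (scalerBr a) (scalerDr alpha) !scalerA (mulrC a) opprD addrACA.
by rewrite scalerDr addrACA.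
Qed.

Definition CD_algebra : algebra :=
  @Algebra (Q * Q)%type CD_mul CD_mul_linear_r CD_mul_linear_l.

(* Even part Q = {(a, 0)}, odd part Q u = {(0, b)}. *)
Definition CD_main (i : 'Z_2) : {vspace CD_algebra} :=
  if i == 0 then lker (linfun (@snd Q Q)) else lker (linfun (@fst Q Q)).

Lemma mem_CD_main (i : 'Z_2) (x : CD_algebra) :
  (x \in CD_main i) = ((if i == 0 then x.2 else x.1) == 0).
Proof. by rewrite /CD_main; case: ifP => _; rewrite memv_ker lfunE. Qed.

Lemma CD_main_grading : is_grading CD_main.
Proof.
have lin0 (U V : lmodType F) (f : U -> V) : linear f -> f 0 = 0.
  by move=> lf; have := lf (-1) 0 0; rewrite addr0 scaler0 scaleN1r addNr.
have m0r (x : Q) : amul x 0 = 0 by apply: lin0; apply: amul_linear_r.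
have m0l (y : Q) : amul 0 y = 0.
  exact: lin0 (@amul_linear_l Q y).
have c0 : hconj 0 = 0 :> Q by apply: lin0; apply: hconj_linear.
have Z2 (i : 'Z_2) : i = 0 \/ i = 1.
  by case: i => [[|[|//]]] lti; [left|right]; apply: val_inj.
split.
- move=> x; exists [:: 0; 1], (fun i : 'Z_2 =>
    if i == 0 then (x.1, 0) : CD_algebra else (0, x.2)).
  split=> [i|]; first by rewrite mem_CD_main; case: (i == 0) => /=.
  rewrite big_cons big_seq1 /=.
  by case: x => a b; congr (_, _); rewrite /= ?addr0 ?add0r.
- move=> s f us fM s0 g gs.
  have key i : g != i -> (if g == 0 then (f i).1 else (f i).2) = 0.
    move: (fM i); rewrite mem_CD_main.
    by case: (Z2 g) => ->; case: (Z2 i) => -> //= /eqP.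
  have eqs : \sum_(i <- s) (if g == 0 then (f i).1 else (f i).2) = 0.
    transitivity (if g == 0 then (\sum_(i <- s) f i : Q * Q).1
                  else (\sum_(i <- s) f i : Q * Q).2).
      by case: (g == 0); rewrite raddf_sum.
    by rewrite s0; case: ifP.
  rewrite (bigD1_seq g) //= big1 ?addr0 in eqs; last first.
    by move=> i ig; apply: key; rewrite eq_sym.
  move: (fM g) eqs; rewrite mem_CD_main.
  by case: (f g) => a b; case: (g == 0) => /= /eqP -> ->.
- move=> g h [a b] [c d]; rewrite !mem_CD_main /amul /= /CD_mul.
  by case: (Z2 g) => ->; case: (Z2 h) => -> /= /eqP -> /eqP ->;
     rewrite ?c0 ?m0r ?m0l ?scaler0 ?subr0 ?addr0.
Qed.

Definition CD : superalgebra := Superalgebra CD_main_grading.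

End CayleyDickson.

Record quaternion_basis (A : algebra) := QuaternionBasis {
  qe1 : A; qe2 : A; qu1 : A; qv1 : A;
  quaternion_basisP : basis_of {:A} [:: qe1; qe2; qu1; qv1];
  quaternion_ee : [/\ amul qe1 qe1 = qe1, amul qe2 qe2 = qe2,
                      amul qe1 qe2 = 0 & amul qe2 qe1 = 0];
  quaternion_eu : [/\ amul qe1 qu1 = qu1, amul qu1 qe2 = qu1,
                      amul qe2 qu1 = 0 & amul qu1 qe1 = 0];
  quaternion_ev : [/\ amul qe2 qv1 = qv1, amul qv1 qe1 = qv1,
                      amul qe1 qv1 = 0 & amul qv1 qe2 = 0];
  quaternion_uv : [/\ amul qu1 qu1 = 0, amul qv1 qv1 = 0,
                      amul qu1 qv1 = - qe1 & amul qv1 qu1 = - qe2] }.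

(* [cu] and [cv] list u_1, u_2, u_3 and v_1, v_2, v_3 from index 0 on (the rules
   are invariant under cyclic shifts); [ordS] is the successor modulo 3. *)
Record cayley_basis (A : algebra) := CayleyBasis {
  ce1 : A; ce2 : A; cu : 'I_3 -> A; cv : 'I_3 -> A;
  cayley_basisP : basis_of {:A} ([:: ce1; ce2] ++ codom cu ++ codom cv);
  cayley_ee : [/\ amul ce1 ce1 = ce1, amul ce2 ce2 = ce2,
                  amul ce1 ce2 = 0 & amul ce2 ce1 = 0];
  cayley_eu : forall i, [/\ amul ce1 (cu i) = cu i, amul (cu i) ce2 = cu i,
                            amul ce2 (cu i) = 0 & amul (cu i) ce1 = 0];
  cayley_ev : forall i, [/\ amul ce2 (cv i) = cv i, amul (cv i) ce1 = cv i,
                            amul ce1 (cv i) = 0 & amul (cv i) ce2 = 0];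
  cayley_uu : forall i, [/\ amul (cu i) (cu (ordS i)) = cv (ordS (ordS i)),
                            amul (cu (ordS i)) (cu i) = - cv (ordS (ordS i))
                          & amul (cu i) (cu i) = 0];
  cayley_vv : forall i, [/\ amul (cv i) (cv (ordS i)) = cu (ordS (ordS i)),
                            amul (cv (ordS i)) (cv i) = - cu (ordS (ordS i))
                          & amul (cv i) (cv i) = 0];
  cayley_uv : forall i j, amul (cu i) (cv j) = - (ce1 *+ (i == j));
  cayley_vu : forall i j, amul (cv i) (cu j) = - (ce2 *+ (i == j)) }.

Definition quaternion_adapted (C : superalgebra) (b : quaternion_basis C) :
    Prop :=
  even_part C = <<[:: qe1 b; qe2 b]>>%VS /\
  odd_part C = <<[:: qu1 b; qv1 b]>>%VS.

(* The indices of u_1, u_2, u_3 in [cu]. *)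
Definition idx1 : 'I_3 := ord0.
Definition idx2 : 'I_3 := lift ord_max ord_max.
Definition idx3 : 'I_3 := ord_max.

Definition cayley_adapted (C : superalgebra) (b : cayley_basis C) : Prop :=
  even_part C = <<[:: ce1 b; ce2 b; cu b idx3; cv b idx3]>>%VS /\
  odd_part C = <<[:: cu b idx1; cu b idx2; cv b idx1; cv b idx2]>>%VS.

(* The component of degree g is spanned by the vectors that are paired with g. *)
Definition span_degrees (A : algebra) (G : zmodType) (s : seq (A * G)) (g : G) :
    {vspace A} :=
  <<[seq p.1 | p <- s & p.2 == g]>>%VS.

Definition Gamma4 (A : algebra) (b : quaternion_basis A) (G : zmodType)
    (g : G) : G -> {vspace A} :=
  span_degrees [:: (qe1 b, 0); (qe2 b, 0); (qu1 b, g); (qv1 b, - g)].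

Definition Gamma8 (A : algebra) (b : cayley_basis A) (G : zmodType)
    (gam : 'I_3 -> G) : G -> {vspace A} :=
  span_degrees ([:: (ce1 b, 0); (ce2 b, 0)]
                  ++ [seq (cu b i, gam i) | i <- enum 'I_3]
                  ++ [seq (cv b i, - gam i) | i <- enum 'I_3]).

End Algebras.

(* Sym(2) permutes the first two indices, embedded in 'I_3 by
   [lift ord_max]; the third index is [ord_max]. *)
Definition triple_equiv (G : zmodType) (gam gam' : 'I_3 -> G) : Prop :=
  exists (sigma : 'S_2) (eps : int),
    (eps = 1 \/ eps = -1) /\
    gam' ord_max = gam ord_max *~ eps /\
    forall i : 'I_2,
      gam' (lift ord_max i) = gam (lift ord_max (sigma i)) *~ eps.

(* Main.v *)
(* In characteristic 2 the Cayley-Dickson double C is itself a Hurwitz algebra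
   with nonsingular polar form.  The trace vanishes on every component of
   nonzero degree, so the even part of degree 0 contains an element of trace 1;
   solving an Artin-Schreier equation makes it an idempotent e of trace 1.  Its
   Peirce spaces eC(1-e) and (1-e)Ce are graded, isotropic and dual to each
   other under the polar form, which pairs the degrees g and -g.  If dim C = 8,
   dual homogeneous pairs (u1, v1), odd, and (u3, v3), even, are completed by
   u2 = v3 v1 and v2 = u3 u1 to a canonical basis, by linearised alternativity.
   Conversely, g1, g2, g3 are recovered up to the equivalence from the supports
   of the even and odd parts, using g1 + g2 + g3 = 0. *)
Require Import Defs.
From HB Require Import structures.
From mathcomp Require Import all_boot all_algebra perm.
From mathcomp Require Import ring.

Set Implicit Arguments.
Unset Strict Implicit.
Unset Printing Implicit Defensive.

Import GRing.Theory.
Local Open Scope ring_scope.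

(** * Hurwitz algebras *)

Section Algebra.
Context {F : fieldType} {A : algebra F}.
Implicit Types (a : F) (x y z : A).

(** A [hurwitz] structure records neither alternativity nor associativity, and in characteristic 2
    regularity only makes the norm anisotropic on the radical of its polar form. Over an
    algebraically closed field, zero trace would make the polar form vanish, and then some c1 + x
    outside the line F1 could be added to the isotropic vectors; so dimension at least 2 provides an
    element of nonzero trace. This kills the radical, and alternativity follows by testing against
    the polar form. Associativity of Q, on which multiplicativity of the norm of the double rests,
    is read off a split basis of Q, built with the same Peirce calculus that later treats C.
    Characteristic 2 also removes the signs from the canonical table, so that exchanging two of the
    indices becomes a symmetry. In the converse the supports determine each degree only up to a sign
    of its own; the zero sum is what turns these signs into a common one. *)

Lemma amulDr x y z : amul x (y + z) = amul x y + amul x z.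
Proof. by have := amul_linear_r x 1 y z; rewrite !scale1r. Qed.

Lemma amulDl x y z : amul (x + y) z = amul x z + amul y z.
Proof. by have := amul_linear_l z 1 x y; rewrite /= !scale1r. Qed.

Lemma amul0r x : amul x 0 = 0.
Proof. by apply: (addIr (amul x 0)); rewrite -amulDr !add0r. Qed.

Lemma amul0l x : amul 0 x = 0.
Proof. by apply: (addIr (amul 0 x)); rewrite -amulDl !add0r. Qed.

Lemma amulZr a x y : amul x (a *: y) = a *: amul x y.
Proof. by have := amul_linear_r x a y 0; rewrite amul0r !addr0. Qed.

Lemma amulZl a x y : amul (a *: x) y = a *: amul x y.
Proof. by have := amul_linear_l y a x 0; rewrite /= amul0l !addr0. Qed.

Lemma amulNr x y : amul x (- y) = - amul x y.
Proof. by rewrite -scaleN1r amulZr scaleN1r. Qed.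

Lemma amulNl x y : amul (- x) y = - amul x y.
Proof. by rewrite -scaleN1r amulZl scaleN1r. Qed.

Lemma amulBr x y z : amul x (y - z) = amul x y - amul x z.
Proof. by rewrite amulDr amulNr. Qed.

Lemma amulBl x y z : amul (x - y) z = amul x z - amul y z.
Proof. by rewrite amulDl amulNl. Qed.

Lemma amul_sumr (I : Type) (s : seq I) (f : I -> A) x :
  amul x (\sum_(i <- s) f i) = \sum_(i <- s) amul x (f i).
Proof.
elim: s => [|i s IH]; first by rewrite !big_nil amul0r.
by rewrite !big_cons amulDr IH.
Qed.

Lemma amul_suml (I : Type) (s : seq I) (f : I -> A) x :
  amul (\sum_(i <- s) f i) x = \sum_(i <- s) amul (f i) x.
Proof.
elim: s => [|i s IH]; first by rewrite !big_nil amul0l.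
by rewrite !big_cons amulDl IH.
Qed.

End Algebra.

Section Hurwitz.
Context {F : fieldType} {H : hurwitz F}.
Implicit Types (a : F) (x y z w : H).

Definition hpolar : H -> H -> F := polar (@hnorm F H).
Definition htrace x : F := hpolar x (hone H).

Lemma hpolarC x y : hpolar x y = hpolar y x.
Proof. by rewrite /hpolar /polar (addrC x) addrAC. Qed.

Lemma hpolarDr x y z : hpolar x (y + z) = hpolar x y + hpolar x z.
Proof.
by have [_ [_ /(_ x 1 y z)]] := hnorm_quadratic H; rewrite scale1r mul1r.
Qed.

Lemma hpolarDl x y z : hpolar (x + y) z = hpolar x z + hpolar y z.
Proof. by rewrite hpolarC hpolarDr !(hpolarC z). Qed.

Lemma hpolar0r x : hpolar x 0 = 0.
Proof. by apply: (addIr (hpolar x 0)); rewrite -hpolarDr !add0r. Qed.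

Lemma hpolar0l x : hpolar 0 x = 0.
Proof. by rewrite hpolarC hpolar0r. Qed.

Lemma hpolarZr a x y : hpolar x (a *: y) = a * hpolar x y.
Proof.
have [_ [_ /(_ x a y 0)]] := hnorm_quadratic H.
by rewrite addr0 -!/(hpolar _ _) hpolar0r addr0.
Qed.

Lemma hpolarZl a x y : hpolar (a *: x) y = a * hpolar x y.
Proof. by rewrite hpolarC hpolarZr hpolarC. Qed.

Lemma hpolarNr x y : hpolar x (- y) = - hpolar x y.
Proof. by rewrite -scaleN1r hpolarZr mulN1r. Qed.

Lemma hpolarNl x y : hpolar (- x) y = - hpolar x y.
Proof. by rewrite -scaleN1r hpolarZl mulN1r. Qed.

Lemma hnorm_add x y : hnorm (x + y) = hnorm x + hnorm y + hpolar x y.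
Proof. by rewrite /hpolar /polar; ring. Qed.

Lemma hnormZ a x : hnorm (a *: x) = a ^+ 2 * hnorm x.
Proof. by have [-> _] := hnorm_quadratic H. Qed.

Lemma hpolar_mull x y z : hpolar (amul x y) (amul x z) = hnorm x * hpolar y z.
Proof. by rewrite /hpolar /polar -amulDr !hnorm_mul !mulrBr. Qed.

Lemma hpolar_mulr x y z : hpolar (amul x z) (amul y z) = hpolar x y * hnorm z.
Proof. by rewrite /hpolar /polar -amulDl !hnorm_mul !mulrBl. Qed.

(** Full linearisation of the multiplicativity of the norm. Putting one argument equal to the unit
    yields the adjunction formulas below. *)
Lemma hpolar_mul2 x y z w :
  hpolar (amul x y) (amul z w) + hpolar (amul x w) (amul z y)
    = hpolar x z * hpolar y w.
Proof.
have := hpolar_mulr x z (y + w).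
rewrite !amulDr !hpolarDl !hpolarDr !hpolar_mulr hnorm_add => E.
apply: (addrI (hpolar x z * (hnorm y + hnorm w))).
by rewrite -mulrDr -E; ring.
Qed.

Lemma hconjE x : hconj x = htrace x *: hone H - x.
Proof. by []. Qed.

Lemma hpolar_adjr x y z : hpolar (amul x y) z = hpolar x (amul z (hconj y)).
Proof.
have := hpolar_mul2 x y z (hone H); rewrite !hone_r => E.
by rewrite hconjE amulBr amulZr hone_r hpolarDr hpolarNr hpolarZr mulrC -E addrK.
Qed.

Lemma hpolar_adjl x y z : hpolar (amul x y) z = hpolar y (amul (hconj x) z).
Proof.
have := hpolar_mul2 x y (hone H) z; rewrite !hone_l => E.
by rewrite hconjE amulBl amulZl hone_l hpolarDr hpolarNr hpolarZr -E (hpolarC _ y) addrK.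
Qed.

End Hurwitz.

Section NonsingularHurwitz.
Context {F : fieldType} {H : hurwitz F} (a0 : H) (ta0 : htrace a0 != 0).
Implicit Types (x y z w : H).
Let one := hone H.

(** For x in the radical, q(x) t(a0) = q(x a0, x) = 0, so a single element of nonzero trace forces
    q(x) = 0, and regularity applies. *)
Lemma hpolar_nondeg x : (forall y, hpolar x y = 0) -> x = 0.
Proof.
move=> x0; apply: (hnorm_regular x0); apply/eqP.
have /eqP := hpolar_mull x a0 (hone H).
by rewrite hone_r hpolarC x0 eq_sym mulf_eq0 (negPf ta0) orbF.
Qed.

Lemma hpolar_inj x y : (forall z, hpolar x z = hpolar y z) -> x = y.
Proof.
move=> E; apply/eqP; rewrite -subr_eq0; apply/eqP/hpolar_nondeg => z.
by rewrite hpolarDl hpolarNl E subrr.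
Qed.

(** Left multiplication by the conjugate is adjoint to left multiplication by x, so pairing both
    sides with z gives q(xy, xz) = q(x) q(y, z). This is the source of alternativity. *)
Lemma amul_conj_l x y : amul (hconj x) (amul x y) = hnorm x *: y.
Proof.
apply: hpolar_inj => z; rewrite hpolarZl -hpolar_mull.
by rewrite hpolarC -hpolar_adjl hpolarC.
Qed.

Lemma amul_conj_r x y : amul (amul y x) (hconj x) = hnorm x *: y.
Proof.
apply: hpolar_inj => z; rewrite hpolarZl mulrC -hpolar_mulr.
by rewrite hpolarC -hpolar_adjr hpolarC.
Qed.

Lemma amul_xx x : amul x x = htrace x *: x - hnorm x *: one.
Proof.
have := amul_conj_l x one; rewrite hone_r hconjE amulBl amulZl hone_l => <-.
by rewrite opprB addrC subrK.
Qed.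

Lemma amul_left_alt x y : amul x (amul x y) = amul (amul x x) y.
Proof.
have := amul_conj_l x y; rewrite hconjE amulBl amulZl hone_l => E.
by rewrite amul_xx amulBl !amulZl hone_l -E opprB addrC subrK.
Qed.

Lemma amul_right_alt x y : amul (amul y x) x = amul y (amul x x).
Proof.
have := amul_conj_r x y; rewrite hconjE amulBr amulZr hone_r => E.
by rewrite amul_xx amulBr !amulZr hone_r -E opprB addrC subrK.
Qed.

Lemma amul_left_alt2 x y z :
  amul x (amul y z) + amul y (amul x z) = amul (amul x y + amul y x) z.
Proof.
have := amul_left_alt (x + y) z; rewrite !(amulDl, amulDr) !amul_left_alt => E.
apply: (addrI (amul (amul x x) z)); apply: (addIr (amul (amul y y) z)).
by move: E; rewrite !addrA => ->.
Qed.

Lemma amul_right_alt2 x y z :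
  amul (amul z x) y + amul (amul z y) x = amul z (amul x y + amul y x).
Proof.
have := amul_right_alt (x + y) z; rewrite !(amulDl, amulDr) !amul_right_alt => E.
apply: (addrI (amul z (amul x x))); apply: (addIr (amul z (amul y y))).
by move: E; rewrite !addrA => E; rewrite -E; congr (_ + _); rewrite addrAC.
Qed.

Lemma amul_sym x y : amul x y + amul y x =
  htrace x *: y + htrace y *: x - hpolar x y *: one.
Proof.
have := amul_xx (x + y); rewrite /htrace hpolarDl hnorm_add !(amulDl, amulDr).
(* Pairing with an arbitrary z turns the vector identity into a scalar one within reach of
   [ring]. *)
rewrite !amul_xx -!/(htrace _) => E; apply: hpolar_inj => z.
move/(congr1 (hpolar^~ z)): E.
rewrite !(hpolarDl, hpolarNl, hpolarZl) => E.
move/eqP: E; rewrite -subr_eq0 => /eqP E.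
by apply: subr0_eq; rewrite -[RHS]E; ring.
Qed.

End NonsingularHurwitz.

(** * Peirce decomposition in characteristic 2 *)

Lemma oppv_char2 (F : fieldType) (V : lmodType F) (x : V) :
  2%N \in [pchar F] -> - x = x.
Proof. by move=> c2; rewrite -scaleN1r oppr_pchar2 // scale1r. Qed.

Lemma addvv_char2 (F : fieldType) (V : lmodType F) (x : V) :
  2%N \in [pchar F] -> x + x = 0.
Proof. by move=> c2; rewrite -{2}[x]oppv_char2 ?subrr. Qed.

Section Peirce.
Context {F : fieldType} (c2 : 2%N \in [pchar F]).
Context {H : hurwitz F}.
Implicit Types (e x y z : H).
Local Notation one := (hone H).

(** In characteristic 2 the unit has trace 0, so trace 1 excludes both trivial idempotents. *)
Definition rank1_idem e := amul e e = e /\ htrace e = 1.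

Definition coidem e := one - e.

(* Membership in the Peirce space e H (1 - e). *)
Definition peirce e x := amul e x = x /\ htrace x = 0.

Definition peirce_proj e x := amul (amul e x) (coidem e).

Lemma htraceD x y : htrace (x + y) = htrace x + htrace y.
Proof. exact: hpolarDl. Qed.

Lemma htraceN x : htrace (- x) = - htrace x.
Proof. exact: hpolarNl. Qed.

Lemma htraceZ a x : htrace (a *: x) = a * htrace x.
Proof. exact: hpolarZl. Qed.

Lemma hpolarxx x : hpolar x x = 0.
Proof.
rewrite /hpolar /polar -mulr2n -scaler_nat hnormZ (pcharf0 c2) expr0n /= mul0r.
by rewrite sub0r -opprD addrr_pchar2 ?oppr0.
Qed.

Lemma htrace1 : htrace one = 0.
Proof. exact: hpolarxx. Qed.

Lemma hone_neq0 (a0 : H) (ta0 : htrace a0 != 0) : one != 0.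
Proof. by apply: contraNneq ta0 => o0; rewrite /htrace o0 hpolar0r. Qed.

Lemma coidemK e : coidem (coidem e) = e.
Proof. by rewrite /coidem opprB addrC subrK. Qed.

Lemma amul_coidem_l e x : amul (coidem e) x = x - amul e x.
Proof. by rewrite amulBl hone_l. Qed.

Lemma amul_coidem_r e x : amul x (coidem e) = x - amul x e.
Proof. by rewrite amulBr hone_r. Qed.

Lemma amul_coidem_split e x : x = amul e x + amul (coidem e) x.
Proof. by rewrite amul_coidem_l addrC subrK. Qed.

Lemma coidem_idem e : rank1_idem e -> rank1_idem (coidem e).
Proof.
case=> ee te; split.
  by rewrite amul_coidem_l amul_coidem_r ee subrr subr0.
by rewrite htraceD htraceN htrace1 te add0r oppr_pchar2.
Qed.

Lemma rank1_idem_conj e : rank1_idem e -> hconj e = coidem e.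
Proof. by case=> _ te; rewrite hconjE te scale1r. Qed.

Lemma rank1_idem_htrace e : rank1_idem e -> htrace e != 0.
Proof. by case=> _ ->; apply: oner_neq0. Qed.

Lemma rank1_idem_norm e : rank1_idem e -> hnorm e = 0.
Proof.
move=> ie; have [ee te] := ie; have ta0 := rank1_idem_htrace ie.
have := amul_xx ta0 e; rewrite ee te scale1r => /eqP.
by rewrite -[X in X == _]subr0 (inj_eq (addrI _)) (inj_eq oppr_inj) eq_sym
  scaler_eq0 (negPf (hone_neq0 ta0)) orbF => /eqP.
Qed.

Lemma hpolar_coidem e : rank1_idem e -> hpolar e (coidem e) = 1.
Proof. by move=> ie; rewrite hpolarDr hpolarNr hpolarxx subr0 -/(htrace _) ie.2. Qed.

Lemma coidem_mull e : rank1_idem e -> amul (coidem e) e = 0.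
Proof. by case=> ee _; rewrite amul_coidem_l ee subrr. Qed.

Lemma coidem_mulr e : rank1_idem e -> amul e (coidem e) = 0.
Proof. by case=> ee _; rewrite amul_coidem_r ee subrr. Qed.

Lemma amul_sym_traceless (a0 : H) (ta0 : htrace a0 != 0) x y :
  htrace x = 0 -> htrace y = 0 ->
  amul x y + amul y x = hpolar x y *: one.
Proof.
move=> tx ty; rewrite (amul_sym ta0) tx ty !scale0r !add0r.
exact: oppv_char2.
Qed.

Lemma amul_anti_traceless (a0 : H) (ta0 : htrace a0 != 0) x y :
  htrace x = 0 -> htrace y = 0 ->
  hpolar x y = 0 -> amul x y = amul y x.
Proof.
move=> tx ty pxy; have := amul_sym_traceless ta0 tx ty.
rewrite pxy scale0r => /eqP; rewrite addr_eq0 => /eqP ->.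
exact: oppv_char2.
Qed.

Section FixedIdempotent.
Context (e : H) (ie : rank1_idem e).
Let ta0 := rank1_idem_htrace ie.

Lemma hpolar_idem_mull x : hpolar e (amul e x) = 0.
Proof.
by have := hpolar_mull e one x; rewrite hone_r (rank1_idem_norm ie) mul0r.
Qed.

(** On eH, right multiplication by e is the projection x -> t(x) e. Hence zero trace means xe = 0
    there, which justifies the form of [peirce]. *)
Lemma amul_idem_r x : amul e x = x -> amul x e = htrace x *: e.
Proof.
move=> ex; have := amul_sym ta0 e x.
rewrite ex ie.2 scale1r -[X in hpolar e X]ex hpolar_idem_mull scale0r subr0.
exact: addrI.
Qed.

Lemma peirce_r0 x : peirce e x -> amul x e = 0.
Proof. by case=> ex tx; rewrite amul_idem_r // tx scale0r. Qed.

Lemma peirce_l0 x : peirce e x -> amul (coidem e) x = 0.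
Proof. by case=> ex _; rewrite amul_coidem_l ex subrr. Qed.

Lemma peirce_r1 x : peirce e x -> amul x (coidem e) = x.
Proof. by move=> ux; rewrite amul_coidem_r peirce_r0 ?subr0. Qed.

Lemma peirce_hpolar_idem x : peirce e x -> hpolar e x = 0.
Proof. by case=> <- _; apply: hpolar_idem_mull. Qed.

Lemma peirce_hpolar_coidem x : peirce e x -> hpolar (coidem e) x = 0.
Proof.
move=> ux; rewrite hpolarDl hpolarNl peirce_hpolar_idem // hpolarC.
by rewrite -/(htrace _) ux.2 subr0.
Qed.

Lemma peirce_norm x : peirce e x -> hnorm x = 0.
Proof. by case=> <- _; rewrite hnorm_mul (rank1_idem_norm ie) mul0r. Qed.

Lemma peirce_hpolar x y : peirce e x -> peirce e y -> hpolar x y = 0.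
Proof.
by case=> <- _ [<- _]; rewrite hpolar_mull (rank1_idem_norm ie) mul0r.
Qed.

Lemma peirce_sq x : peirce e x -> amul x x = 0.
Proof.
by move=> ux; rewrite (amul_xx ta0) ux.2 peirce_norm // !scale0r subr0.
Qed.

Lemma peirceZ a x : peirce e x -> peirce e (a *: x).
Proof. by case=> ex tx; split; rewrite ?amulZr ?ex // htraceZ tx mulr0. Qed.

Lemma peirce_proj_in x : peirce e (peirce_proj e x).
Proof.
have ey : amul e (amul e x) = amul e x by rewrite (amul_left_alt ta0) ie.1.
rewrite /peirce_proj amul_coidem_r amul_idem_r //; split.
  by rewrite amulBr ey amulZr ie.1.
by rewrite htraceD htraceN htraceZ ie.2 mulr1 subrr.
Qed.

Lemma amul_idem_decomp x :
  amul e x = htrace (amul e x) *: e + peirce_proj e x.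
Proof.
have ey : amul e (amul e x) = amul e x by rewrite (amul_left_alt ta0) ie.1.
by rewrite /peirce_proj amul_coidem_r amul_idem_r // addrC subrK.
Qed.

(** Linearised left alternativity gives e(xy) + x(ey) = (ex + xe)y, that is, e(xy) + xy = xy. The
    trace of xy is -q(x, y), which vanishes because the Peirce space is totally isotropic. *)
Lemma peirce_mul x y : peirce e x -> peirce e y ->
  peirce (coidem e) (amul x y).
Proof.
move=> ux uy; have [ex tx] := ux; have [ey ty] := uy; split; last first.
  rewrite /htrace hpolar_adjr hconjE hone_l hpolarDr hpolarNr hpolarZr ty mul0r.
  by rewrite peirce_hpolar // subr0.
have := amul_left_alt2 ta0 e x y.
rewrite ex ey peirce_r0 // addr0 => /eqP.
by rewrite -subr_eq0 addrK amul_coidem_l => /eqP ->; rewrite subr0.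
Qed.

End FixedIdempotent.

Lemma peirce_colK e v : rank1_idem e -> peirce (coidem e) v ->
  amul e v = 0 /\ amul v e = v.
Proof.
move=> ie vv; rewrite -[e in amul e v]coidemK -[e in amul v e]coidemK.
have ie' := coidem_idem ie.
by rewrite peirce_l0 ?peirce_r1.
Qed.

(** Multiplying uv + vu = q(u, v)1 by e on the left keeps uv and kills vu, both by linearised
    alternativity. *)
Lemma peirce_mul_dual e u v : rank1_idem e ->
  peirce e u -> peirce (coidem e) v -> amul u v = hpolar u v *: e.
Proof.
move=> ie uu vv; have [ev0 ve] := peirce_colK ie vv.
have e_uv : amul e (amul u v) = amul u v.
  have := amul_left_alt2 (rank1_idem_htrace ie) e u v.
  by rewrite ev0 amul0r addr0 uu.1 (peirce_r0 ie uu) addr0.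
have e_vu : amul e (amul v u) = 0.
  have := amul_left_alt2 (rank1_idem_htrace ie) e v u.
  by rewrite ev0 add0r ve uu.1 => /eqP; rewrite -subr_eq0 addrK => /eqP.
have /(congr1 (amul e)) := amul_sym_traceless (rank1_idem_htrace ie) uu.2 vv.2.
by rewrite amulDr e_uv e_vu addr0 amulZr hone_r.
Qed.

Lemma peirce_dual_mul e u v : rank1_idem e ->
  peirce e u -> peirce (coidem e) v -> amul v u = hpolar u v *: coidem e.
Proof.
move=> ie uu vv; rewrite hpolarC.
by apply: peirce_mul_dual vv _; [apply: coidem_idem | rewrite coidemK].
Qed.

(** The conjugate of e is 1 - e, so multiplications by e and by 1 - e are adjoint to each other, and
    u sees only the component of z in (1 - e)He. Nondegeneracy thus becomes duality of the two
    Peirce spaces. *)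
Lemma peirce_hpolar_proj e u z : rank1_idem e -> peirce e u ->
  hpolar u z = hpolar u (peirce_proj (coidem e) z).
Proof.
move=> ie uu; have ie' := coidem_idem ie.
rewrite /peirce_proj -(rank1_idem_conj ie') -hpolar_adjr peirce_r1 //.
by rewrite -(rank1_idem_conj ie) -hpolar_adjl uu.1.
Qed.

(** In characteristic 2 the square of a + c1 is a - q(a)1 + c^2 1, and this equals a + c1 exactly
    when c^2 + c = q(a). *)
Lemma exists_rank1_idem (a0 a : H) :
  htrace a0 != 0 -> htrace a = 1 -> (exists c, c ^+ 2 + c = hnorm a) ->
  exists c, rank1_idem (a + c *: one).
Proof.
move=> ta0 ta [c Ec]; exists c; split; last first.
  by rewrite htraceD htraceZ htrace1 mulr0 addr0.
rewrite !(amulDl, amulDr) !(amulZl, amulZr) !(hone_l, hone_r) scalerA -expr2.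
rewrite (amul_xx ta0) ta scale1r -Ec scalerDl -addrA -[RHS]addr0.
rewrite (oppv_char2 _ c2) !addrA (ACl (1*3*(4*5)*(2*6))) /=.
by rewrite !(addvv_char2 _ c2) !addr0.
Qed.

End Peirce.

(** * Linear extension from spanning families *)

Lemma scalar_eq0_or (F : fieldType) (V : vectType F) (f : V -> F) :
  scalar f -> (forall x, f x = 0) \/ exists x, f x != 0.
Proof.
move=> lf; have f0 : f 0 = 0.
  by have := lf (-1) 0 0; rewrite scaler0 addr0 mulN1r addNr.
have fS (I : Type) (s : seq I) (a : I -> F) (v : I -> V) :
    f (\sum_(i <- s) a i *: v i) = \sum_(i <- s) a i * f (v i).
  by elim: s => [|i s IH]; rewrite ?big_nil // !big_cons lf IH.
(* Checking the finitely many basis vectors decides the alternative constructively. *)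
case: (boolP (has (fun x => f x != 0) (vbasis {:V}))) => [/hasP[x _]|].
  by right; exists x.
rewrite -all_predC => /allP f_basis; left=> x.
rewrite (coord_vbasis (memvf x)) fS big1 // => i _.
have /f_basis /= : (vbasis {:V})`_i \in vbasis {:V}.
  by rewrite mem_nth // size_tuple.
by rewrite negbK => /eqP ->; rewrite mulr0.
Qed.

Lemma exists_notin_span (F : fieldType) (V : vectType F) (s : seq V) :
  (size s < \dim {:V})%N -> exists x, x \notin <<s>>%VS.
Proof.
move=> lt_s; have /subvPn[x _ xs] : ~~ (fullv <= <<s>>)%VS; last by exists x.
by apply: contraL lt_s => /dimvS le_s; rewrite -leqNgt (leq_trans le_s) ?dim_span.
Qed.

(** The maps are bare functions with a proof of linearity because [amul] comes in this form, in
    either argument. *)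
Lemma linear_eq_on_span (F : fieldType) (U V : vectType F) (f g : U -> V)
    (s : seq U) :
  linear f -> linear g -> (forall x, x \in s -> f x = g x) ->
  forall x, x \in <<s>>%VS -> f x = g x.
Proof.
move=> lf lg fg x /(@coord_span _ _ _ (in_tuple s)) ->.
have l0 (h : U -> V) : linear h -> h 0 = 0.
  by move=> lh; have := lh (-1) 0 0; rewrite scaler0 addr0 scaleN1r addNr.
have lS (h : U -> V) (I : Type) (r : seq I) (a : I -> F) (v : I -> U) :
    linear h -> h (\sum_(i <- r) a i *: v i) = \sum_(i <- r) a i *: h (v i).
  by move=> lh; elim: r => [|i r IH]; rewrite ?big_nil ?l0 // !big_cons lh IH.
rewrite !lS //; apply: eq_bigr => i _; congr (_ *: _).
by apply: fg; rewrite mem_nth // size_tuple.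
Qed.

Lemma amul_assoc_on_span (F : fieldType) (A : algebra F) (s : seq A) :
  <<s>>%VS = fullv ->
  (forall x y z : A, x \in s -> y \in s -> z \in s ->
     amul (amul x y) z = amul x (amul y z)) ->
  forall x y z : A, amul (amul x y) z = amul x (amul y z).
Proof.
move=> sT assoc_s.
have sP (x : A) : x \in <<s>>%VS by rewrite sT memvf.
have assoc_r x y : x \in s -> y \in s ->
    forall z, amul (amul x y) z = amul x (amul y z).
  move=> xs ys z; apply: (@linear_eq_on_span _ _ _ (amul (amul x y))
            (fun z => amul x (amul y z)) s) (sP z) => [a z1 z2|a z1 z2|w ws].
  - exact: amul_linear_r.
  - by rewrite !(amulDr, amulZr).
  - exact: assoc_s.
have assoc_m x : x \in s ->
    forall y z, amul (amul x y) z = amul x (amul y z).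
  move=> xs y z; move: y (sP y).
  apply: (@linear_eq_on_span _ _ _ (fun y => amul (amul x y) z)
            (fun y => amul x (amul y z)) s) => [a y1 y2|a y1 y2|w ws].
  - by rewrite !(amulDr, amulZr, amulDl, amulZl).
  - by rewrite !(amulDr, amulZr, amulDl, amulZl).
  - exact: assoc_r.
move=> x y z; move: x (sP x).
apply: (@linear_eq_on_span _ _ _ (fun x => amul (amul x y) z)
            (fun x => amul x (amul y z)) s) => [a y1 y2|a y1 y2|w ws].
- by rewrite !(amulDl, amulZl).
- by rewrite !(amulDl, amulZl).
- exact: assoc_m.
Qed.

Lemma quaternion_basis_assoc (F : fieldType) (A : algebra F)
    (b : quaternion_basis A) (x y z : A) :
  amul (amul x y) z = amul x (amul y z).
Proof.
have bT := span_basis (quaternion_basisP b).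
move: x y z; apply: (amul_assoc_on_span bT) => x y z.
have [ee1 ee2 ee3 ee4] := quaternion_ee b.
have [eu1 eu2 eu3 eu4] := quaternion_eu b.
have [ev1 ev2 ev3 ev4] := quaternion_ev b.
have [uv1 uv2 uv3 uv4] := quaternion_uv b.
have tab := (ee1, ee2, ee3, ee4, eu1, eu2, eu3, eu4, ev1, ev2, ev3, ev4,
             uv1, uv2, uv3, uv4, @amul0l F A, @amul0r F A, @amulNl F A, @amulNr F A, @oppr0 A).
rewrite !inE => /or4P[] /eqP-> /or4P[] /eqP-> /or4P[] /eqP->; by rewrite !tab.
Qed.

(** Pairing with y is a linear form equal to 1 at x and to 0 on s, so x lies outside the span of
    s. *)
Lemma free_cons_hpolar (F : fieldType) (H : hurwitz F) (x y : H) (s : seq H) :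
  hpolar x y = 1 -> all (fun z => hpolar z y == 0) s -> free s -> free (x :: s).
Proof.
move=> xy /allP sy fs; rewrite free_cons fs andbT.
(* The linear form is multiplied by the unit because [linear_eq_on_span] compares maps with values
   in a vector space. *)
apply/negP => xs; have : hpolar x y *: hone H = 0 *: hone H.
  apply: (@linear_eq_on_span _ _ _ (fun x => hpolar x y *: hone H)
    (fun _ => 0 *: hone H) s) xs => [a u v|a u v|u /sy /eqP ->] //.
  - by rewrite hpolarDl hpolarZl scalerDl scalerA.
  - by rewrite !scale0r scaler0 addr0.
rewrite xy scale0r scale1r => o0; have := oner_neq0 F.
by rewrite -xy -[x]hone_r o0 amul0r hpolar0l eqxx.
Qed.

(** * Idempotents and split bases over an algebraically closed field *)

Section ClosedChar2.
Context {F : closedFieldType} (c2 : 2%N \in [pchar F]).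

(** If the trace vanished, so would the polar form, since q(x, y) is a trace by adjunction;
    regularity would then make the norm anisotropic. But for x outside F1 a square root c of
    -q(x)/q(1) makes c1 + x a nonzero isotropic vector. *)
Lemma exists_htrace_neq0 (H : hurwitz F) :
  (1 < \dim {:H})%N -> exists a : H, htrace a != 0.
Proof.
move=> dimH.
have [a y x|t0|//] := @scalar_eq0_or F H htrace; first by rewrite htraceD htraceZ.
have b0 (x y : H) : hpolar x y = 0.
  rewrite -[x]hone_l hpolar_adjr hpolarC.
  exact: t0.
have [x x1] := @exists_notin_span _ _ [:: hone H] dimH.
have reg0 (y : H) : hnorm y = 0 -> y = 0.
  by move=> y0; apply: hnorm_regular => // z; apply: b0.
have q1 : hnorm (hone H) != 0.
  apply: contraNneq x1 => q0; rewrite (reg0 x) ?mem0v //.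
  by rewrite -[x]hone_l hnorm_mul q0 mul0r.
have [c] := @solve_monicpoly F 2
  (fun i => if i == 0%N then - hnorm x / hnorm (hone H) else 0) isT.
rewrite !big_ord_recl big_ord0 /= mul0r !addr0 expr0 mulr1 => Ec.
have : c *: hone H + x = 0.
  by apply: reg0; rewrite hnorm_add b0 addr0 hnormZ Ec mulfVK // addNr.
move/eqP; rewrite addrC addr_eq0 => /eqP x0; case/negP: x1.
by rewrite x0 span_seq1 rpredN rpredZ // memv_line.
Qed.

Lemma exists_artin_schreier (d : F) : exists c : F, c ^+ 2 + c = d.
Proof.
have [c] := @solve_monicpoly F 2 (fun i => if i == 0%N then d else -1) isT.
rewrite !big_ord_recl big_ord0 /= addr0 expr0 expr1 mulr1 mulN1r => E.
by exists c; rewrite E subrK.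
Qed.

Section Nonsingular.
Context {H : hurwitz F} (a0 : H) (ta0 : htrace a0 != 0).

Lemma hpolar_witness (x : H) : x != 0 -> exists y, hpolar x y = 1.
Proof.
move=> x0; have [a y z|b0|[y xy]] := @scalar_eq0_or F H (hpolar x).
- by rewrite hpolarDr hpolarZr.
- by rewrite (hpolar_nondeg ta0 b0) eqxx in x0.
by exists ((hpolar x y)^-1 *: y); rewrite hpolarZr mulVf.
Qed.

Lemma rank1_idem_shift (a : H) : htrace a = 1 ->
  exists c, rank1_idem (a + c *: hone H).
Proof.
by move=> ta; apply: exists_rank1_idem => //; [exact: ta0|exact: exists_artin_schreier].
Qed.

End Nonsingular.

(** An x outside the span of e and 1 - e has a nonzero component in one of the two Peirce spaces. If
    it is the wrong one, a vector paired with that component has a nonzero component in the right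
    one. *)
Lemma exists_peirce_proj_neq0 (H : hurwitz F) (e : H) :
  (2 < \dim {:H})%N -> rank1_idem e ->
  exists x, peirce_proj e x != 0.
Proof.
move=> dimH ie; have ie' := coidem_idem c2 ie.
have [x xe] := @exists_notin_span _ _ [:: e; coidem e] dimH.
have [px|] := eqVneq (peirce_proj e x) 0; last by exists x.
have [px'|/(hpolar_witness (rank1_idem_htrace ie))[z]] := eqVneq (peirce_proj (coidem e) x) 0.
  case/negP: xe; rewrite (amul_coidem_split e x).
  rewrite (amul_idem_decomp ie) px addr0.
  rewrite (amul_idem_decomp ie') px' addr0.
  by rewrite rpredD // rpredZ // memv_span // !inE eqxx ?orbT.
have vv := peirce_proj_in ie' x.
rewrite (peirce_hpolar_proj c2 _ ie' vv) coidemK => pz.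
by exists z; apply: contra_eqN pz => /eqP ->; rewrite hpolar0r eq_sym oner_eq0.
Qed.

Lemma peirce_dual_exists (H : hurwitz F) (e u : H) :
  rank1_idem e -> peirce e u -> u != 0 ->
  exists v, peirce (coidem e) v /\ hpolar u v = 1.
Proof.
move=> ie uu /(hpolar_witness (rank1_idem_htrace ie))[z]; rewrite (peirce_hpolar_proj c2 _ ie uu).
exists (peirce_proj (coidem e) z); split=> //.
exact: (peirce_proj_in (coidem_idem c2 ie)).
Qed.

(** The polar form pairs e with 1 - e and u with v, so each vector has a partner orthogonal to all
    later ones; this gives freeness. Characteristic 2 supplies the signs in uv = -e and vu = -(1 -
    e). *)
Lemma peirce_quaternion_basis (H : hurwitz F) (e u v : H) : \dim {:H} = 4%N ->
  rank1_idem e -> peirce e u -> peirce (coidem e) v -> hpolar u v = 1 ->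
  exists b : quaternion_basis H,
    [/\ qe1 b = e, qe2 b = coidem e, qu1 b = u & qv1 b = v].
Proof.
move=> dimH ie uu vv uv; have ie' := coidem_idem c2 ie.
have [ev0 ve] := peirce_colK c2 ie vv.
have bP : basis_of {:H} [:: e; coidem e; u; v].
  rewrite basisEfree subvf dimH !andbT.
  apply: (@free_cons_hpolar _ _ _ (coidem e)); first exact: hpolar_coidem.
    by rewrite /= hpolarxx // !(hpolarC _ (coidem e)) (peirce_hpolar_coidem ie)
      ?(peirce_hpolar_idem ie') ?eqxx.
  apply: (@free_cons_hpolar _ _ _ e); first by rewrite hpolarC hpolar_coidem.
    rewrite /= !(hpolarC _ e) (peirce_hpolar_idem ie) // -{1}[e]coidemK.
    by rewrite (peirce_hpolar_coidem ie') // eqxx.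
  apply: (@free_cons_hpolar _ _ _ v) => //; first by rewrite /= hpolarxx // eqxx.
  by apply: (@free_cons_hpolar _ _ _ u); rewrite ?nil_free // hpolarC.
have t1 : [/\ amul e e = e, amul (coidem e) (coidem e) = coidem e,
              amul e (coidem e) = 0 & amul (coidem e) e = 0].
  by rewrite (coidem_mull ie) (coidem_mulr ie); split=> //; case: ie ie' => ? ? [].
have t2 : [/\ amul e u = u, amul u (coidem e) = u,
              amul (coidem e) u = 0 & amul u e = 0].
  by rewrite (peirce_r1 ie) // (peirce_l0 uu) (peirce_r0 ie) //; split=> //; case: uu.
have t3 : [/\ amul (coidem e) v = v, amul v e = v,
              amul e v = 0 & amul v (coidem e) = 0].
  by rewrite (peirce_r0 ie') //; split=> //; case: vv.
have t4 : [/\ amul u u = 0, amul v v = 0,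
              amul u v = - e & amul v u = - coidem e].
  rewrite (peirce_sq ie uu) (peirce_sq ie' vv).
  rewrite (peirce_mul_dual c2 ie uu vv) (peirce_dual_mul c2 ie uu vv).
  by rewrite uv !scale1r !(oppv_char2 _ c2).
by exists (QuaternionBasis bP t1 t2 t3 t4).
Qed.

(** In dimension 4 the algebra has a canonical basis, in dimension 2 it is spanned by e and 1 - e;
    associativity is then a finite check on the table. It is what multiplicativity of the norm of
    the double requires. *)
Lemma hurwitz_assoc (H : hurwitz F) :
  \dim {:H} = 2%N \/ \dim {:H} = 4%N ->
  forall x y z : H, amul (amul x y) z = amul x (amul y z).
Proof.
move=> dimH.
have [a0 ta0] : exists a : H, htrace a != 0.
  by apply: exists_htrace_neq0; case: dimH => ->.
have [|c ie] := @rank1_idem_shift _ _ ta0 ((htrace a0)^-1 *: a0).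
  by rewrite htraceZ mulVf.
move: (_ + _) ie => e ie {c}; have ie' := coidem_idem c2 ie.
case: dimH => dimH; last first.
  have [|x /(peirce_dual_exists ie)] := @exists_peirce_proj_neq0 H e _ ie.
    by rewrite dimH.
  case=> [|v [vv uv]]; first exact: (peirce_proj_in ie).
  have uu := peirce_proj_in ie x.
  have [b _] := peirce_quaternion_basis dimH ie uu vv uv.
  exact: (quaternion_basis_assoc b).
apply: (@amul_assoc_on_span _ _ [:: e; coidem e]).
  apply: span_basis; rewrite basisEfree subvf dimH !andbT.
  apply: (@free_cons_hpolar _ _ _ (coidem e)); first exact: hpolar_coidem.
    by rewrite /= hpolarxx // eqxx.
  by apply: (@free_cons_hpolar _ _ _ e); rewrite ?nil_free // hpolarC hpolar_coidem.
move=> x y z; rewrite !inE.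
have tab := (ie.1, ie'.1, coidem_mull ie, coidem_mulr ie, @amul0l F H, @amul0r F H).
by move=> /orP[] /eqP-> /orP[] /eqP-> /orP[] /eqP->; rewrite !tab.
Qed.

End ClosedChar2.

(** * The Cayley-Dickson double as a Hurwitz algebra *)

Section CayleyDicksonHurwitz.
Context {F : closedFieldType} (c2 : 2%N \in [pchar F]).
Context (Q : hurwitz F) (dimQ : \dim {:Q} = 2%N \/ \dim {:Q} = 4%N).
Context (alpha : F) (alpha_neq0 : alpha != 0).
Local Notation A := (CD_algebra Q alpha).

Lemma exists_rank1_idem_dim24 : exists e : Q, rank1_idem e.
Proof.
have [a0 ta0] : exists a : Q, htrace a != 0.
  by apply: exists_htrace_neq0; case: dimQ => ->.
have [|c ie] := @rank1_idem_shift _ c2 _ _ ta0 ((htrace a0)^-1 *: a0).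
  by rewrite htraceZ mulVf.
by exists ((htrace a0)^-1 *: a0 + c *: hone Q).
Qed.

Lemma hconjK (x : Q) : hconj (hconj x) = x.
Proof.
by rewrite !hconjE htraceD htraceZ htraceN (htrace1 c2) mulr0 add0r
  oppr_pchar2 // opprB addrC subrK.
Qed.

Lemma hconj_one : hconj (hone Q) = hone Q.
Proof. by rewrite hconjE (htrace1 c2) scale0r add0r (oppv_char2 _ c2). Qed.

Lemma hnorm_one : hnorm (hone Q) = 1.
Proof.
have [e ie] := exists_rank1_idem_dim24; have ie' := coidem_idem c2 ie.
have -> : hone Q = e + coidem e by rewrite addrC subrK.
by rewrite hnorm_add !rank1_idem_norm // hpolar_coidem // !add0r.
Qed.

Lemma hnorm_conj (x : Q) : hnorm (hconj x) = hnorm x.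
Proof.
rewrite hconjE hnorm_add hnormZ hnorm_one mulr1 (oppv_char2 x c2).
by rewrite hpolarZl hpolarC -/(htrace x) addrAC expr2 addrr_pchar2 // add0r.
Qed.

Definition CD_norm (x : A) : F := hnorm x.1 + alpha * hnorm x.2.

Definition CD_one : A := (hone Q, 0).

Lemma hconj0 : hconj 0 = 0 :> Q.
Proof. by rewrite hconjE /htrace hpolar0l scale0r subr0. Qed.

Lemma CD_one_l (x : A) : amul CD_one x = x.
Proof.
by case: x => a b; rewrite /amul /= /CD_mul /= hone_l hone_r amul0r amul0l
  scaler0 subr0 addr0.
Qed.

Lemma CD_one_r (x : A) : amul x CD_one = x.
Proof.
by case: x => a b; rewrite /amul /= /CD_mul /= hconj0 hconj_one !hone_r !amul0l
  scaler0 subr0 add0r.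
Qed.

Lemma CD_polarE (x y : A) :
  polar CD_norm x y = hpolar x.1 y.1 + alpha * hpolar x.2 y.2.
Proof. by rewrite /polar /CD_norm /= !hnorm_add; ring. Qed.

Lemma CD_norm_quadratic : quadratic_form CD_norm.
Proof.
split=> [a x|]; first by rewrite /CD_norm /= !hnormZ; ring.
split=> x a y z; rewrite !CD_polarE /=.
  by rewrite !(hpolarDl, hpolarZl); ring.
by rewrite !(hpolarDr, hpolarZr); ring.
Qed.

Lemma CD_norm_regular : regular_form CD_norm.
Proof.
have [e /rank1_idem_htrace te] := exists_rank1_idem_dim24.
move=> [a b] ab _; congr (_, _); apply: (hpolar_nondeg te) => c.
  by have := ab (c, 0); rewrite CD_polarE /= hpolar0r mulr0 addr0.
have := ab (0, c); rewrite CD_polarE /= hpolar0r add0r => /eqP.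
by rewrite mulf_eq0 (negPf alpha_neq0) => /eqP.
Qed.

Lemma CD_norm_mul (x y : A) : CD_norm (amul x y) = CD_norm x * CD_norm y.
Proof.
case: x y => [a b] [c d].
have assoc := hurwitz_assoc c2 dimQ.
(* Both sides equal q(b, dac), bracketed as d(ac) on the left and (da)c on the right; this is where
   associativity of Q enters. It makes the mixed terms of the norms of the two coordinates
   cancel. *)
have cross : hpolar (amul a c) (amul (hconj d) b) =
             hpolar (amul d a) (amul b (hconj c)).
  by rewrite hpolarC hpolar_adjl hconjK [RHS]hpolarC hpolar_adjr hconjK assoc.
rewrite /CD_norm /amul /= /CD_mul /= !hnorm_add hpolarNr hpolarZr cross.
rewrite (oppv_char2 _ c2) hnormZ !hnorm_mul !hnorm_conj; ring.
Qed.

Definition CD_hurwitz : hurwitz F :=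
  @Hurwitz F A CD_one CD_norm CD_one_l CD_one_r CD_norm_quadratic
    CD_norm_regular CD_norm_mul.

Lemma hpolar_CD (x y : CD_hurwitz) :
  hpolar x y = hpolar (x.1 : Q) (y.1 : Q) + alpha * hpolar (x.2 : Q) (y.2 : Q).
Proof. exact: CD_polarE. Qed.

Lemma htrace_CD (x : CD_hurwitz) : htrace x = htrace (x.1 : Q).
Proof. by rewrite /htrace hpolar_CD /= hpolar0r mulr0 addr0. Qed.

Lemma CD_even_mul (a : Q) (x : A) :
  amul ((a, 0) : A) x = (amul a x.1, amul x.2 a).
Proof. by rewrite /amul /= /CD_mul /= amul0r amul0l scaler0 subr0 addr0. Qed.

Lemma CD_mul_even (a : Q) (x : A) :
  amul x ((a, 0) : A) = (amul x.1 a, amul x.2 (hconj a)).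
Proof. by rewrite /amul /= /CD_mul /= hconj0 !amul0l scaler0 subr0 add0r. Qed.

Lemma rank1_idem_CD (e : Q) : rank1_idem e -> @rank1_idem F CD_hurwitz (e, 0).
Proof.
case=> ee te; split; last by rewrite htrace_CD.
by rewrite [LHS]CD_even_mul /= ee amul0l.
Qed.

Lemma even_part_CD (x : CD Q alpha) :
  (x \in even_part (CD Q alpha)) = (x.2 == 0).
Proof. exact: mem_CD_main. Qed.

Lemma odd_part_CD (x : CD Q alpha) : (x \in odd_part (CD Q alpha)) = (x.1 == 0).
Proof. exact: mem_CD_main. Qed.

Lemma dim_CD : \dim {:A} = (\dim {:Q} + \dim {:Q})%N.
Proof. by rewrite !dimvf. Qed.

End CayleyDicksonHurwitz.

(** * Canonical bases from dual pairs *)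

Lemma ord3P (P : 'I_3 -> Prop) : P idx1 -> P idx2 -> P idx3 -> forall i, P i.
Proof.
move=> P1 P2 P3 [[|[|[|//]]] lti].
- by rewrite (_ : Ordinal lti = idx1) //; apply: val_inj.
- by rewrite (_ : Ordinal lti = idx2) //; apply: val_inj.
- by rewrite (_ : Ordinal lti = idx3) //; apply: val_inj.
Qed.

Lemma enum_ord3 : enum 'I_3 = [:: idx1; idx2; idx3].
Proof. by apply: (inj_map val_inj); rewrite val_enum_ord. Qed.

Lemma codom_ord3 (T : Type) (f : 'I_3 -> T) :
  codom f = [:: f idx1; f idx2; f idx3].
Proof. by rewrite /codom /image_mem enum_ord3. Qed.

Lemma ordS_idx1 : ordS idx1 = idx2. Proof. exact: val_inj. Qed.
Lemma ordS_idx2 : ordS idx2 = idx3. Proof. exact: val_inj. Qed.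
Lemma ordS_idx3 : ordS idx3 = idx1. Proof. exact: val_inj. Qed.
Definition ordS_idx := (ordS_idx1, ordS_idx2, ordS_idx3).

Section CayleyBasis.
Context {F : closedFieldType} (c2 : 2%N \in [pchar F]).
Context {H : hurwitz F}.

Record peirce_quad (e u1 v1 u3 v3 : H) : Prop := PeirceQuad {
  pq_idem : rank1_idem e;
  pq_u1 : peirce e u1; pq_v1 : peirce (coidem e) v1;
  pq_u3 : peirce e u3; pq_v3 : peirce (coidem e) v3;
  pq_u1v1 : hpolar u1 v1 = 1; pq_u3v3 : hpolar u3 v3 = 1;
  pq_u1v3 : hpolar u1 v3 = 0; pq_u3v1 : hpolar u3 v1 = 0 }.

(** Through this symmetry each identity proved for u2 = v3 v1 also gives its mirror image for v2 =
    u3 u1. *)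
Lemma peirce_quad_sym e u1 v1 u3 v3 :
  peirce_quad e u1 v1 u3 v3 -> peirce_quad (coidem e) v1 u1 v3 u3.
Proof.
by case=> ie ? ? ? ? ? ? ? ?; split; rewrite ?coidemK // 1?hpolarC //;
  apply: coidem_idem.
Qed.

Section Quad.
Context (e u1 v1 u3 v3 : H) (pq : peirce_quad e u1 v1 u3 v3).
Let ie := pq_idem pq.
Let ie' := coidem_idem c2 ie.
Let te := rank1_idem_htrace ie.

(** Linearised left alternativity: u1(v3 v1) + v3(u1 v1) = (u1 v3 + v3 u1)v1 = 0, where u1 v1 = e
    and v3 e = v3. *)
Lemma peirce_quad_mul12 : amul u1 (amul v3 v1) = v3.
Proof.
have := amul_left_alt2 te u1 v3 v1.
rewrite (peirce_mul_dual c2 ie (pq_u1 pq) (pq_v1 pq)) (pq_u1v1 pq) scale1r.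
rewrite (peirce_mul_dual c2 ie (pq_u1 pq) (pq_v3 pq)) (pq_u1v3 pq).
rewrite (peirce_dual_mul c2 ie (pq_u1 pq) (pq_v3 pq)) (pq_u1v3 pq).
rewrite !scale0r addr0 amul0l (peirce_colK c2 ie (pq_v3 pq)).2.
by move/eqP; rewrite addr_eq0 (oppv_char2 _ c2) => /eqP.
Qed.

(** Linearised right alternativity: (v3 v1)u3 + (v3 u3)v1 = v3(v1 u3 + u3 v1) = 0, where v3 u3 = 1 -
    e fixes v1 on the left. *)
Lemma peirce_quad_mul23 : amul (amul v3 v1) u3 = v1.
Proof.
have := amul_right_alt2 te v1 u3 v3.
rewrite (peirce_mul_dual c2 ie (pq_u3 pq) (pq_v1 pq)) (pq_u3v1 pq).
rewrite (peirce_dual_mul c2 ie (pq_u3 pq) (pq_v1 pq)) (pq_u3v1 pq).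
rewrite (peirce_dual_mul c2 ie (pq_u3 pq) (pq_v3 pq)) (pq_u3v3 pq).
rewrite scale1r !scale0r addr0 amul0r (pq_v1 pq).1.
by move/eqP; rewrite addr_eq0 (oppv_char2 _ c2) => /eqP.
Qed.

Lemma peirce_quad_u2 : peirce e (amul v3 v1).
Proof. by rewrite -[e]coidemK; apply: peirce_mul; [|case: pq|case: pq]. Qed.

Lemma peirce_quad_u2v1 : hpolar (amul v3 v1) v1 = 0.
Proof.
rewrite -[X in hpolar _ X]hone_l hpolar_mulr (peirce_norm ie' (pq_v1 pq)).
by rewrite mulr0.
Qed.

Lemma peirce_quad_u2v3 : hpolar (amul v3 v1) v3 = 0.
Proof.
rewrite -[X in hpolar _ X]hone_r hpolar_mull (peirce_norm ie' (pq_v3 pq)).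
by rewrite mul0r.
Qed.

(** In the linearised norm identity the second term contains v3 u1, which is 0 because q(u1, v3) =
    0. *)
Lemma peirce_quad_u2v2 : hpolar (amul v3 v1) (amul u3 u1) = 1.
Proof.
have := hpolar_mul2 v3 v1 u3 u1.
rewrite (peirce_dual_mul c2 ie (pq_u1 pq) (pq_v3 pq)) (pq_u1v3 pq).
rewrite scale0r hpolar0l addr0 hpolarC => ->.
by rewrite hpolarC (pq_u3v3 pq) hpolarC (pq_u1v1 pq) mulr1.
Qed.

End Quad.

Lemma peirce_cayley_basis e u1 v1 u3 v3 : \dim {:H} = 8%N ->
  peirce_quad e u1 v1 u3 v3 ->
  exists b : cayley_basis H,
    [/\ ce1 b = e, ce2 b = coidem e,
        [/\ cu b idx1 = u1, cu b idx2 = amul v3 v1 & cu b idx3 = u3] &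
        [/\ cv b idx1 = v1, cv b idx2 = amul u3 u1 & cv b idx3 = v3]].
Proof.
move=> dimH pq; have pq' := peirce_quad_sym pq.
have ie := pq_idem pq; have ie' := pq_idem pq'; have te := rank1_idem_htrace ie.
pose u := fun i : 'I_3 => nth 0 [:: u1; amul v3 v1; u3] i.
pose v := fun i : 'I_3 => nth 0 [:: v1; amul u3 u1; v3] i.
have uu i : peirce e (u i).
  by elim/ord3P: i; rewrite /u /=; [case: pq| exact: peirce_quad_u2 pq |case: pq].
have vv i : peirce (coidem e) (v i).
  by elim/ord3P: i; rewrite /v /=; [case: pq| exact: peirce_quad_u2 pq' |case: pq].
have uv i j : hpolar (u i) (v j) = (i == j)%:R.
  elim/ord3P: i; elim/ord3P: j; rewrite /u /v /=;
    try by case: pq.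
  - by rewrite hpolarC (peirce_quad_u2v1 pq').
  - by rewrite (peirce_quad_u2v1 pq).
  - by rewrite (peirce_quad_u2v2 pq).
  - by rewrite (peirce_quad_u2v3 pq).
  - by rewrite hpolarC (peirce_quad_u2v3 pq').
have vu i j : hpolar (v i) (u j) = (i == j)%:R by rewrite hpolarC uv eq_sym.
have ue i : hpolar (u i) e = 0 by rewrite hpolarC (peirce_hpolar_idem ie).
have ue' i : hpolar (u i) (coidem e) = 0.
  by rewrite hpolarC (peirce_hpolar_coidem ie).
have ve i : hpolar (v i) (coidem e) = 0.
  by rewrite hpolarC (peirce_hpolar_idem ie').
have ve' i : hpolar (v i) e = 0.
  by rewrite hpolarC -[e in hpolar e]coidemK (peirce_hpolar_coidem ie').
have uu0 i j : hpolar (u i) (u j) = 0 by apply: peirce_hpolar (uu _) (uu _).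
have vv0 i j : hpolar (v i) (v j) = 0 by apply: peirce_hpolar (vv _) (vv _).
have bP : basis_of {:H} ([:: e; coidem e] ++ codom u ++ codom v).
  rewrite !codom_ord3 basisEfree subvf dimH !andbT /=.
  have tab := (uv, vu, ue, ue', ve, ve', uu0, vv0, hpolarxx c2, eqxx).
  apply: (@free_cons_hpolar _ _ _ (coidem e)); rewrite ?hpolar_coidem //=.
    by rewrite !tab.
  apply: (@free_cons_hpolar _ _ _ e); rewrite 1?hpolarC ?hpolar_coidem //=.
    by rewrite !tab.
  have free_cu i (s : seq H) : all (fun z => hpolar z (v i) == 0) s ->
      free s -> free (u i :: s).
    by apply: free_cons_hpolar; rewrite uv eqxx.
  have free_cv i (s : seq H) : all (fun z => hpolar z (u i) == 0) s ->
      free s -> free (v i :: s).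
    by apply: free_cons_hpolar; rewrite vu eqxx.
  do 3![apply: (free_cu); first by rewrite /= !tab].
  do 2![apply: (free_cv); first by rewrite /= !tab].
  by apply: (free_cv); rewrite ?nil_free.
have t1 : [/\ amul e e = e, amul (coidem e) (coidem e) = coidem e,
              amul e (coidem e) = 0 & amul (coidem e) e = 0].
  by rewrite (coidem_mull ie) (coidem_mulr ie); split=> //; case: ie ie' => ? ? [].
have t2 i : [/\ amul e (u i) = u i, amul (u i) (coidem e) = u i,
                amul (coidem e) (u i) = 0 & amul (u i) e = 0].
  by rewrite (peirce_r1 ie) // (peirce_l0 (uu i)) (peirce_r0 ie) //; split=> //; case: (uu i).
have t3 i : [/\ amul (coidem e) (v i) = v i, amul (v i) e = v i,
                amul e (v i) = 0 & amul (v i) (coidem e) = 0].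
  have [ev ve1] := peirce_colK c2 ie (vv i).
  by rewrite (peirce_r0 ie') //; split=> //; case: (vv i).
have t4 i : [/\ amul (u i) (u (ordS i)) = v (ordS (ordS i)),
                amul (u (ordS i)) (u i) = - v (ordS (ordS i))
              & amul (u i) (u i) = 0].
  (* For the third index the rule is the definition of v2; only u1 u2 = v3 and u2 u3 = v1 carry
     content. The reversed products follow because traceless orthogonal elements anticommute. *)
  have E : amul (u i) (u (ordS i)) = v (ordS (ordS i)).
    elim/ord3P: i; rewrite !ordS_idx /u /v //=.
      exact: peirce_quad_mul12 pq.
    exact: peirce_quad_mul23 pq.
  rewrite (peirce_sq ie (uu i)) (oppv_char2 _ c2) -E; split=> //.
  by rewrite (amul_anti_traceless c2 te) //; case: (uu i) (uu (ordS i)) => ? ? [].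
have t5 i : [/\ amul (v i) (v (ordS i)) = u (ordS (ordS i)),
                amul (v (ordS i)) (v i) = - u (ordS (ordS i))
              & amul (v i) (v i) = 0].
  have E : amul (v i) (v (ordS i)) = u (ordS (ordS i)).
    elim/ord3P: i; rewrite !ordS_idx /u /v //=.
      exact: peirce_quad_mul12 pq'.
    exact: peirce_quad_mul23 pq'.
  rewrite (peirce_sq ie' (vv i)) (oppv_char2 _ c2) -E; split=> //.
  by rewrite (amul_anti_traceless c2 te) //; case: (vv i) (vv (ordS i)) => ? ? [].
have t6 i j : amul (u i) (v j) = - (e *+ (i == j)).
  by rewrite (peirce_mul_dual c2 ie) // uv scaler_nat (oppv_char2 _ c2).
have t7 i j : amul (v i) (u j) = - (coidem e *+ (i == j)).
  by rewrite (peirce_dual_mul c2 ie) // uv scaler_nat (oppv_char2 _ c2) eq_sym.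
by exists (CayleyBasis bP t1 t2 t3 t4 t5 t6 t7).
Qed.

End CayleyBasis.

(** * Gradings *)

Section Grading.
Context {F : fieldType} {A : algebra F} {G : zmodType} {Gam : G -> {vspace A}}.
Hypothesis gr : is_grading Gam.

(** Uniqueness of homogeneous components, in a form that allows repeated degrees among the summands:
    they are first grouped by degree, since [grading_free] speaks of duplicate-free lists of
    degrees. *)
Lemma grading_component (I : eqType) (r : seq I) (phi : I -> G) (y : I -> A)
    (h : G) (x : A) :
  x \in Gam h -> (forall i, i \in r -> y i \in Gam (phi i)) ->
  x = \sum_(i <- r) y i -> x = \sum_(i <- r | phi i == h) y i.
Proof.
move=> xh yP Ex; pose c k := \sum_(i <- r | phi i == k) y i.
(* The degree h is added by hand, as possibly no summand has it. *)
pose s := undup (h :: map phi r).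
have cP k : c k \in Gam k.
  by rewrite /c big_seq_cond; apply: rpred_sum => i /andP[/yP yi /eqP <-].
have := @grading_free _ _ _ _ gr s (fun k => c k - (if k == h then x else 0)).
move=> /(_ (undup_uniq _)) free0; apply/esym/eqP; rewrite -subr_eq0; apply/eqP.
have hs : h \in s by rewrite mem_undup mem_head.
have := free0 _ _ h hs; rewrite eqxx; apply=> [k|].
  by rewrite rpredB //; case: eqP => [->|_]; rewrite ?mem0v.
rewrite big_split /= sumrN [X in _ - X](bigD1_seq h) ?undup_uniq //= eqxx.
rewrite [X in x + X]big1 => [|k /negPf ->//]; rewrite addr0.
apply/eqP; rewrite subr_eq0 Ex /c (exchange_big_dep xpredT) //=.
rewrite big_seq [X in _ == X]big_seq; apply/eqP/eq_bigr => i ir.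
rewrite big_mkcond (bigD1_seq (phi i)) ?undup_uniq //=; last first.
  by rewrite mem_undup inE map_f ?orbT.
by rewrite eqxx big1 ?addr0 // => k; rewrite eq_sym => /negPf ->.
Qed.

Lemma grading_disjoint (g h : G) (x : A) :
  x \in Gam g -> x \in Gam h -> g != h -> x = 0.
Proof.
move=> xg xh gh.
have := @grading_component _ [:: x] (fun=> g) id h x xh.
rewrite !big_cons !big_nil (negPf gh) addr0; apply=> //.
by move=> y; rewrite inE => /eqP->.
Qed.

(** A homogeneous spanning family determines the grading: in an expansion of x of degree g, only the
    terms of degree g survive. It applies both to the given grading and to the main one. *)
Lemma grading_eq_span (s : seq (A * G)) :
  <<[seq p.1 | p <- s]>>%VS = fullv -> (forall p, p \in s -> p.1 \in Gam p.2) ->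
  forall g, Gam g = span_degrees s g.
Proof.
move=> sT sP g; apply/vspaceP => x; apply/idP/idP; last first.
  apply: subvP; apply/span_subvP => y /mapP[p]; rewrite mem_filter.
  by move=> /andP[/eqP <- /sP ps] ->.
move=> xg; have xs : x \in <<[seq p.1 | p <- s]>>%VS by rewrite sT memvf.
have [c Ec] : exists c : nat -> F,
    x = \sum_(i < size s) c i *: (nth (0, 0) s i).1.
  have /= := @coord_span _ _ _ (in_tuple [seq p.1 | p <- s]) _ xs.
  (* The coordinates are indexed by the length of the mapped list; extending them by 0 to all
     naturals avoids transport between the two ordinal types. *)
  move=> E; exists (fun i => if insub i is Some j
                      then coord (in_tuple [seq p.1 | p <- s]) j x else 0).
  rewrite [LHS]E; move: (coord _) => f.
  rewrite -(big_mkord xpredT (fun i =>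
    (if insub i is Some j then f j x else 0) *: (nth (0, 0) s i).1)).
  rewrite -(size_map (fun p => p.1) s) big_mkord; apply: eq_bigr => i _.
  rewrite valK; congr (_ *: _); rewrite (nth_map (0, 0)) //.
  by move: (ltn_ord i); rewrite {2}size_map.
have nP i : (i < size s)%N -> nth (0, 0) s i \in s by apply: mem_nth.
have -> := @grading_component _ (index_enum 'I_(size s))
  (fun i => (nth (0, 0) s i).2) (fun i => c i *: (nth (0, 0) s i).1) g x xg _ Ec.
  apply: rpred_sum => i /eqP ig; apply: rpredZ; apply: memv_span.
  by apply/mapP; exists (nth (0, 0) s i); rewrite // mem_filter ig eqxx nP.
by move=> i _; apply: rpredZ; apply: sP; apply: nP.
Qed.

End Grading.

(** * Unit, trace and polar form of a graded Hurwitz algebra *)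

Section HurwitzGrading.
Context {F : fieldType} {H : hurwitz F} (a0 : H) (ta0 : htrace a0 != 0).
Context {G : zmodType} {Gam : G -> {vspace H}} (gr : is_grading Gam).

(** Let c be the component of degree 0 of the unit. Comparing degrees in x = 1x shows that cx = x
    for homogeneous x, hence c = c1 = 1. *)
Lemma grading_hone : hone H \in Gam 0.
Proof.
have [s [f [fP E1]]] := grading_span gr (hone H).
pose c := \sum_(g <- s | g == 0) f g.
have cP : c \in Gam 0 by apply: rpred_sum => g /eqP g0; rewrite -[X in Gam X]g0.
suff <- : c = hone H by [].
have cx h x : x \in Gam h -> amul c x = x.
  move=> xh; rewrite /c big_mkcond amul_suml.
  rewrite [RHS](@grading_component _ _ _ _ gr _ s (fun g => g + h)
    (fun g => amul (f g) x) h) //.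
  - rewrite [RHS]big_mkcond; apply: eq_bigr => g _.
    by rewrite -{2}[h]add0r (inj_eq (addIr _)); case: eqP => //; rewrite amul0l.
  - by move=> g _; apply: (grading_mul gr).
  - by rewrite -amul_suml -E1 hone_l.
by rewrite -[LHS]hone_r E1 amul_sumr; apply: eq_bigr => g _; apply: (cx g).
Qed.

(** In t(x)x = x^2 + q(x)1 the right-hand terms have degrees 2g and 0, both different from g, so
    t(x)x = 0. *)
Lemma grading_htrace (g : G) (x : H) : x \in Gam g -> g != 0 -> htrace x = 0.
Proof.
move=> xg g0.
have txE : htrace x *: x = amul x x + hnorm x *: hone H.
  by rewrite (amul_xx ta0) subrK.
have := @grading_component _ _ _ _ gr _ [:: true; false]
  (fun b : bool => if b then g + g else 0)
  (fun b : bool => if b then amul x x else hnorm x *: hone H) g (htrace x *: x).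
have gg : (g + g == g) = false by rewrite -subr_eq0 addrK (negPf g0).
rewrite !big_cons !big_nil /= addr0 gg eq_sym (negPf g0).
move=> /(_ (rpredZ _ xg)) E; have : htrace x *: x = 0.
  apply: E => // -[] _; first exact: (grading_mul gr).
  by rewrite rpredZ // grading_hone.
move/eqP; rewrite scaler_eq0 => /orP[/eqP //|/eqP->].
by rewrite /htrace hpolar0l.
Qed.

(** By adjunction q(x, y) = t(x)t(y) - t(xy). If g + h is nonzero, then t(xy) = 0 and one of the
    degrees g, h is nonzero, so that the product of the traces vanishes too. *)
Lemma grading_hpolar (g h : G) (x y : H) :
  x \in Gam g -> y \in Gam h -> hpolar x y != 0 -> h = - g.
Proof.
move=> xg yh; apply: contra_neq_eq => gh.
have gh0 : g + h != 0 by rewrite addrC addr_eq0.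
have : htrace (amul x y) = 0 by apply: grading_htrace gh0; apply: (grading_mul gr).
rewrite /htrace hpolar_adjr hone_l hconjE hpolarDr hpolarZr hpolarNr.
rewrite -!/(htrace _).
have -> : htrace y * htrace x = 0; last by move/eqP; rewrite sub0r oppr_eq0 => /eqP.
have [g0|] := eqVneq g 0; last by move/(grading_htrace xg) ->; rewrite mulr0.
rewrite g0 add0r in gh0.
by rewrite (grading_htrace yh gh0) mul0r.
Qed.

End HurwitzGrading.

Lemma Z2P (i : 'Z_2) : i = 0 \/ i = 1.
Proof. by case: i => [[|[|//]]] lti; [left|right]; apply: val_inj. Qed.

(** * Homogeneous elements of given parity *)

Section SuperGrading.
Context {F : closedFieldType} (c2 : 2%N \in [pchar F]).
Context (Q : hurwitz F) (dimQ : \dim {:Q} = 2%N \/ \dim {:Q} = 4%N).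
Context (alpha : F) (alpha_neq0 : alpha != 0).
Local Notation C := (CD Q alpha).
Local Notation H := (CD_hurwitz c2 dimQ alpha_neq0).

Definition parity_proj (i : 'Z_2) (x : C) : C :=
  if i == 0 then (x.1, 0) else (0, x.2).

Lemma mem_main_CD (i : 'Z_2) (x : C) :
  (x \in main_grading C i) = ((if i == 0 then x.2 else x.1) == 0).
Proof. exact: mem_CD_main. Qed.

Lemma parity_proj_in i x : parity_proj i x \in main_grading C i.
Proof. by rewrite mem_main_CD /parity_proj; case: (Z2P i) => -> /=; exact: eqxx. Qed.

Lemma parity_proj_id i x : x \in main_grading C i -> parity_proj i x = x.
Proof.
rewrite mem_main_CD /parity_proj.
by case: x => a b; case: (Z2P i) => -> /eqP /= ->.
Qed.

Lemma parity_projD i x y :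
  parity_proj i (x + y) = parity_proj i x + parity_proj i y.
Proof.
by rewrite /parity_proj; case: (Z2P i) => ->; congr (_, _); rewrite /= addr0.
Qed.

Lemma parity_proj_sum i (I : Type) (s : seq I) (f : I -> C) :
  parity_proj i (\sum_(k <- s) f k) = \sum_(k <- s) parity_proj i (f k).
Proof.
elim: s => [|k s IH]; last by rewrite !big_cons parity_projD IH.
by rewrite !big_nil /parity_proj; case: (Z2P i) => ->.
Qed.

Lemma hpolar_parity i (x y : H) : x \in main_grading C i ->
  hpolar x y = hpolar x (parity_proj i y : H).
Proof.
rewrite mem_main_CD /parity_proj !hpolar_CD.
by case: x => a b; case: (Z2P i) => -> /eqP /= ->;
  rewrite hpolar0r hpolar0l ?mulr0 ?addr0.
Qed.

Lemma main_mul_even (i : 'Z_2) (e : Q) (x : C) : x \in main_grading C i ->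
  amul ((e, 0) : C) x \in main_grading C i /\
  amul x ((e, 0) : C) \in main_grading C i.
Proof.
have e0 : ((e, 0) : C) \in main_grading C 0 by rewrite mem_main_CD /=.
have gr := main_gradingP C.
by move=> xi; split; [rewrite -[i]add0r | rewrite -[i]addr0];
  apply: (grading_mul gr).
Qed.

Lemma coidem_CD (e : Q) : coidem ((e, 0) : H) = (coidem e, 0) :> C.
Proof. by congr (_, _); rewrite /= subr0. Qed.

Lemma peirce_proj_even (i : 'Z_2) (e : Q) (x : C) : x \in main_grading C i ->
  @peirce_proj _ H (e, 0) x \in main_grading C i.
Proof.
move=> xi; rewrite /peirce_proj coidem_CD.
exact: (main_mul_even _ (main_mul_even e xi).1).2.
Qed.

Section Homogeneous.
Context (G : zmodType) (Gam : G -> {vspace C}) (sg : is_super_grading Gam).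
Let gr : is_grading Gam := sg.1.

(** Compatibility of the grading with the main grading enters the construction through this
    statement. *)
Lemma parity_proj_homog i g x : x \in Gam g -> parity_proj i x \in Gam g.
Proof.
have [_ Eg] := sg.2 g; rewrite Eg => /memv_addP[a + [b + ->]].
rewrite !memv_cap even_part_CD odd_part_CD => /andP[ag /eqP a2] /andP[bg /eqP b1].
rewrite -Eg /parity_proj; case: (Z2P i) => -> /=.
  suff -> : ((a + b).1, 0) = a by [].
  by case: a a2 {ag} => a b' /= ->; rewrite b1 addr0.
suff -> : (0, (a + b).2) = b by [].
by case: b b1 {bg} => b b' /= ->; rewrite a2 add0r.
Qed.

(** The homogeneous components of x, projected to parity i, still sum to x, so the linear form
    cannot vanish on all of them. This turns every existence statement below into one about a
    nonzero linear form. *)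
Lemma exists_homogeneous i (f : C -> F) x : scalar f ->
  x \in main_grading C i -> f x != 0 ->
  exists g y, [/\ y \in Gam g, y \in main_grading C i & f y != 0].
Proof.
move=> lf xi fx.
have fD y z : f (y + z) = f y + f z by have := lf 1 y z; rewrite scale1r mul1r.
have f0 : f 0 = 0 by apply: (addIr (f 0)); rewrite -fD !add0r.
have [s [y [yP Ex]]] := grading_span gr x.
have : has (fun g => f (parity_proj i (y g)) != 0) s.
  apply: contraNT fx; rewrite -all_predC => /allP fs.
  rewrite -(parity_proj_id xi) Ex parity_proj_sum.
  elim: s fs {Ex} => [|g s IH] fs; first by rewrite big_nil f0.
  rewrite big_cons fD; have := fs g (mem_head _ _); rewrite /= negbK => /eqP ->.
  by rewrite add0r; apply: IH => h hs; apply: fs; rewrite inE hs orbT.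
case/hasP => g _ fg; exists g, (parity_proj i (y g)); split=> //.
  exact: parity_proj_homog.
exact: parity_proj_in.
Qed.

Lemma exists_homogeneous_idem :
  exists e : Q, rank1_idem e /\ ((e, 0) : C) \in Gam 0.
Proof.
have [e ie] := exists_rank1_idem_dim24 c2 dimQ.
have te : htrace ((e, 0) : H) != 0 by rewrite htrace_CD rank1_idem_htrace.
have [|||g [y [yg yi ty]]] := @exists_homogeneous 0 (@htrace _ H) (e, 0).
- by move=> a x y; rewrite htraceD htraceZ.
- by rewrite mem_main_CD /=.
- exact: te.
have g0 : g = 0.
  by apply: contraNeq ty => g0; rewrite (grading_htrace te gr yg g0).
move: yg; rewrite g0 => y0 {g g0}.
move: yi; rewrite mem_main_CD /=.
case: y y0 ty => a b y0 + /eqP /= b0; rewrite htrace_CD /= => ta.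
move: y0; rewrite b0 => a0 {b b0}.
have [|c ic] := @rank1_idem_shift _ c2 _ _ ta ((htrace a)^-1 *: a).
  by rewrite htraceZ mulVf.
exists ((htrace a)^-1 *: a + c *: hone Q); split=> //.
have -> : ((htrace a)^-1 *: a + c *: hone Q, 0) =
          (htrace a)^-1 *: ((a, 0) : C) + c *: (hone H : C).
  by congr (_, _); rewrite /= !scaler0 addr0.
apply: rpredD; first exact: rpredZ.
by apply: rpredZ; apply: (@grading_hone _ H _ Gam gr).
Qed.

Section HomogeneousIdem.
Context (e : Q) (ie : rank1_idem e) (e0 : ((e, 0) : C) \in Gam 0).
Let E : H := (e, 0).
Let iE : rank1_idem E := rank1_idem_CD c2 dimQ alpha_neq0 ie.

Lemma peirce_proj_homog g (x : C) :
  x \in Gam g -> (@peirce_proj _ H E x \in Gam g) /\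
                 (@peirce_proj _ H (coidem E) x \in Gam g).
Proof.
have cE : (coidem E : C) \in Gam 0.
  by rewrite rpredB //; apply: (@grading_hone _ H _ Gam gr).
move=> xg; rewrite /peirce_proj coidemK.
by split; rewrite -[g]addr0 -[g in g + 0]add0r;
   apply: (grading_mul gr) => //; apply: (grading_mul gr).
Qed.

Lemma hpolar_peirce_proj_scalar (e1 z : H) :
  scalar (fun x => hpolar z (peirce_proj e1 x)).
Proof.
move=> a x y; rewrite /peirce_proj; move: (coidem e1) => d.
by rewrite !(amulDr, amulDl, amulZr, amulZl)
  hpolarDr hpolarZr.
Qed.

Lemma exists_homogeneous_pair i (x : C) :
  x \in main_grading C i -> @peirce_proj _ H E x != 0 ->
  exists g (u v : H),
    [/\ u \in Gam g, v \in Gam (- g),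
        u \in main_grading C i, v \in main_grading C i &
        [/\ peirce E u, peirce (coidem E) v & hpolar u v = 1]].
Proof.
move=> xi /(hpolar_witness (rank1_idem_htrace iE))[w].
rewrite hpolarC => pw.
(* Pairing with w replaces a nonzero projection by a nonzero value of a linear form. *)
have [|||g [y [yg yi py]]] := @exists_homogeneous i
  (fun x => @hpolar _ H w (peirce_proj E x)) x.
- exact: hpolar_peirce_proj_scalar.
- exact: xi.
- by rewrite pw oner_neq0.
pose u : H := peirce_proj E y.
have u0 : u != 0.
  by apply: contraNneq py => u0; rewrite -/u u0 hpolar0r.
have uu : peirce E u by apply: (peirce_proj_in iE).
have ui : u \in main_grading C i by apply: peirce_proj_even.
have ug : u \in Gam g by case: (peirce_proj_homog yg).
have [z] := hpolar_witness (rank1_idem_htrace iE) u0.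
(* The partner z of u may mix parities; since u has parity i, only the part of z of parity i
   contributes. *)
rewrite (hpolar_parity _ ui) (peirce_hpolar_proj c2 _ iE uu) => pz.
have [|||h [y' [yg' yi' py']]] := @exists_homogeneous i
  (fun x => @hpolar _ H u (peirce_proj (coidem E) x)) (parity_proj i z).
- exact: hpolar_peirce_proj_scalar.
- exact: parity_proj_in.
- by rewrite pz oner_neq0.
pose v0 : H := peirce_proj (coidem E) y'.
have vg0 : v0 \in Gam h by case: (peirce_proj_homog yg').
have hg : h = - g.
  exact: (grading_hpolar (rank1_idem_htrace iE) gr ug vg0 py').
exists g, u, ((hpolar u v0)^-1 *: v0); split=> //.
- by apply: rpredZ; rewrite -hg.
- apply: rpredZ; rewrite /v0 /E coidem_CD; exact: peirce_proj_even.
- split=> //; last by rewrite hpolarZr mulVf.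
  apply: peirceZ; apply: peirce_proj_in; exact: (coidem_idem c2 iE).
Qed.

(** In the double, e(bu) and (bu)(1 - e) are both (be)u, so the odd part of the Peirce space is
    (Qe)u, and eu is a nonzero element fixed by the projection. *)
Lemma odd_peirce_proj_neq0 :
  exists x : C, x \in main_grading C 1 /\ @peirce_proj _ H E x != 0.
Proof.
exists (0, e); split; first by rewrite mem_main_CD.
rewrite /peirce_proj coidem_CD [amul E _]CD_even_mul /= amul0r.
rewrite [X in X != 0](@CD_mul_even _ _ alpha (coidem e) (0, amul e e)) /=.
rewrite amul0l (rank1_idem_conj (coidem_idem c2 ie)) coidemK !ie.1.
apply/eqP => -[e00]; have := rank1_idem_htrace ie.
by rewrite e00 /htrace hpolar0l eqxx.
Qed.

Lemma even_peirce_proj_neq0 : \dim {:Q} = 4%N ->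
  exists x : C, x \in main_grading C 0 /\ @peirce_proj _ H E x != 0.
Proof.
move=> dQ; have [|x px] := @exists_peirce_proj_neq0 _ c2 Q e _ ie.
  by rewrite dQ.
exists (x, 0); split; first by rewrite mem_main_CD /=.
rewrite /peirce_proj coidem_CD [amul E _]CD_even_mul /= amul0l.
rewrite [X in X != 0](@CD_mul_even _ _ alpha (coidem e) (amul e x, 0)) /= amul0l.
by apply: contra_neq px => -[].
Qed.

End HomogeneousIdem.

End Homogeneous.

End SuperGrading.

Lemma even_odd_disjoint (F : fieldType) (A : superalgebra F) (x : A) :
  x \in even_part A -> x \in odd_part A -> x = 0.
Proof.
by move=> xe xo; apply: (grading_disjoint (main_gradingP A) xe xo).
Qed.

(** * Adapted canonical bases with homogeneous elements *)

Section CanonicalGrading.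
Context {F : closedFieldType} (c2 : 2%N \in [pchar F]).
Context (Q : hurwitz F) (dimQ : \dim {:Q} = 2%N \/ \dim {:Q} = 4%N).
Context (alpha : F) (alpha_neq0 : alpha != 0).
Local Notation C := (CD Q alpha).
Local Notation H := (CD_hurwitz c2 dimQ alpha_neq0).

(** Applying the existence results to the main grading itself produces an adapted canonical
    basis. *)
Lemma CD_main_super_grading : is_super_grading (main_grading C).
Proof.
split=> [|i]; first exact: main_gradingP.
have eo0 : (even_part C :&: odd_part C)%VS = 0%VS.
  apply/eqP; rewrite -subv0; apply/subvP => x; rewrite memv_cap memv0.
  by move=> /andP[xe xo]; rewrite (even_odd_disjoint xe xo).
split.
  apply/directv_addP/eqP; rewrite -subv0 -eo0.
  by rewrite capvS ?capvSr.
case: (Z2P i) => ->; rewrite -/(even_part C) -/(odd_part C) capvv.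
  by rewrite eo0 addv0.
by rewrite (capvC (odd_part C)) eo0 add0v.
Qed.

Lemma quaternion_adapted_degrees (b : quaternion_basis C) :
  qe1 b \in main_grading C 0 -> qe2 b \in main_grading C 0 ->
  qu1 b \in main_grading C 1 -> qv1 b \in main_grading C 1 ->
  quaternion_adapted b.
Proof.
move=> e1 e2 u1 v1.
pose s : seq (C * 'Z_2) := [:: (qe1 b, 0); (qe2 b, 0); (qu1 b, 1); (qv1 b, 1)].
have sT : <<[seq p.1 | p <- s]>>%VS = fullv by apply: span_basis (quaternion_basisP b).
have sP p : p \in s -> p.1 \in main_grading C p.2.
  by rewrite !inE => /or4P[] /eqP->.
have Eg := grading_eq_span (main_gradingP C) sT sP.
by split; [exact: Eg 0|exact: Eg 1].
Qed.

Lemma cayley_adapted_degrees (b : cayley_basis C) :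
  [/\ ce1 b \in main_grading C 0, ce2 b \in main_grading C 0,
      cu b idx3 \in main_grading C 0 & cv b idx3 \in main_grading C 0] ->
  [/\ cu b idx1 \in main_grading C 1, cu b idx2 \in main_grading C 1,
      cv b idx1 \in main_grading C 1 & cv b idx2 \in main_grading C 1] ->
  cayley_adapted b.
Proof.
move=> [e1 e2 u3 v3] [u1 u2 v1 v2].
pose s : seq (C * 'Z_2) :=
  [:: (ce1 b, 0); (ce2 b, 0); (cu b idx3, 0); (cv b idx3, 0);
      (cu b idx1, 1); (cu b idx2, 1); (cv b idx1, 1); (cv b idx2, 1)].
have sT : <<[seq p.1 | p <- s]>>%VS = fullv.
  rewrite -(span_basis (cayley_basisP b)); apply: eq_span => x.
  rewrite !codom_ord3 /= !inE; do 8!case: (x == _) => //=.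
have sP p : p \in s -> p.1 \in main_grading C p.2.
  by rewrite !inE; do 4![case/orP=> [/eqP-> //|]]; case/or4P => /eqP->.
have Eg := grading_eq_span (main_gradingP C) sT sP.
by split; [exact: Eg 0|exact: Eg 1].
Qed.

Context (G : zmodType) (Gam : G -> {vspace C}) (sg : is_super_grading Gam).
Let gr : is_grading Gam := sg.1.

Lemma quaternion_basis_grading (b : quaternion_basis C) g :
  qe1 b \in Gam 0 -> qe2 b \in Gam 0 ->
  qu1 b \in Gam g -> qv1 b \in Gam (- g) ->
  forall h, Gam h = Gamma4 b g h.
Proof.
move=> e1 e2 u1 v1; apply: (grading_eq_span gr).
  by apply: span_basis (quaternion_basisP b).
by move=> p; rewrite !inE => /or4P[] /eqP->.
Qed.

Lemma Gamma8_span (b : cayley_basis C) (gam : 'I_3 -> G) :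
  [seq p.1 | p <- [:: (ce1 b, 0); (ce2 b, 0)]
                  ++ [seq (cu b i, gam i) | i <- enum 'I_3]
                  ++ [seq (cv b i, - gam i) | i <- enum 'I_3]] =
  [:: ce1 b; ce2 b] ++ codom (cu b) ++ codom (cv b).
Proof. by rewrite enum_ord3 !codom_ord3. Qed.

Lemma cayley_basis_grading (b : cayley_basis C) (gam : 'I_3 -> G) :
  ce1 b \in Gam 0 -> ce2 b \in Gam 0 ->
  (forall i, cu b i \in Gam (gam i)) -> (forall i, cv b i \in Gam (- gam i)) ->
  forall h, Gam h = Gamma8 b gam h.
Proof.
move=> e1 e2 uP vP; apply: (grading_eq_span gr).
  by rewrite Gamma8_span; apply: span_basis (cayley_basisP b).
move=> p; rewrite !mem_cat !inE -orbA => /or4P[/eqP->|/eqP->|/mapP[i _ ->]|/mapP[i _ ->]] //=.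
Qed.

Lemma even_idem_main (e : Q) :
  (((e, 0) : C) \in main_grading C 0) *
  ((coidem ((e, 0) : H) : C) \in main_grading C 0).
Proof. by rewrite coidem_CD !mem_main_CD /= eqxx. Qed.

Lemma even_idem_homog (e : Q) : ((e, 0) : C) \in Gam 0 ->
  (coidem ((e, 0) : H) : C) \in Gam 0.
Proof.
by move=> e0; rewrite rpredB //; apply: (@grading_hone _ H _ Gam gr).
Qed.

Lemma exists_Gamma4 : \dim {:C} = 4%N ->
  exists (b : quaternion_basis C) (g : G),
    quaternion_adapted b /\ forall h, Gam h = Gamma4 b g h.
Proof.
move=> dimC.
have [e [ie e0]] := exists_homogeneous_idem c2 dimQ alpha_neq0 sg.
have iE : @rank1_idem _ H (e, 0) := rank1_idem_CD c2 dimQ alpha_neq0 ie.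
have [x [x1 px]] := odd_peirce_proj_neq0 c2 dimQ alpha_neq0 ie.
have [g [u [v [ug vg u1 v1 [uu vv uv]]]]] :=
  exists_homogeneous_pair sg ie e0 x1 px.
have [b [b1 b2 b3 b4]] :=
  @peirce_quaternion_basis _ c2 H _ u v dimC iE uu vv uv.
have e0' := even_idem_homog e0; have [em em'] := even_idem_main e.
exists b, g; split.
  by apply: quaternion_adapted_degrees; rewrite ?b1 ?b2 ?b3 ?b4.
by apply: quaternion_basis_grading; rewrite ?b1 ?b2 ?b3 ?b4.
Qed.

Lemma exists_Gamma8 : \dim {:C} = 8%N ->
  exists (b : cayley_basis C) (gam : 'I_3 -> G),
    [/\ cayley_adapted b, \sum_i gam i = 0 & forall h, Gam h = Gamma8 b gam h].
Proof.
move=> dimC.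
have dimQ4 : \dim {:Q} = 4%N.
  by case: dimQ => // dQ; move: dimC; rewrite [LHS]dim_CD dQ.
have [e [ie e0]] := exists_homogeneous_idem c2 dimQ alpha_neq0 sg.
have iE : @rank1_idem _ H (e, 0) := rank1_idem_CD c2 dimQ alpha_neq0 ie.
have [x [x1 px]] := odd_peirce_proj_neq0 c2 dimQ alpha_neq0 ie.
have [y [y0 py]] := even_peirce_proj_neq0 c2 dimQ alpha_neq0 ie dimQ4.
have [g1 [u1 [v1 [u1g v1g u11 v11 [uu1 vv1 uv1]]]]] :=
  exists_homogeneous_pair sg ie e0 x1 px.
have [g3 [u3 [v3 [u3g v3g u30 v30 [uu3 vv3 uv3]]]]] :=
  exists_homogeneous_pair sg ie e0 y0 py.
(* The even and odd parts are orthogonal, which supplies the two mixed conditions of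
   [peirce_quad]. *)
have odd_even (z w : H) : z \in main_grading C 1 -> w \in main_grading C 0 ->
    hpolar z w = 0.
  move=> z1; rewrite mem_main_CD /= => /eqP w2.
  rewrite (hpolar_parity _ z1) (_ : parity_proj 1 w = 0) ?hpolar0r //.
  by rewrite /parity_proj /= w2.
have pq : peirce_quad ((e, 0) : H) u1 v1 u3 v3.
  by split=> //; rewrite 1?[hpolar u3 _]hpolarC odd_even.
have [b [b1 b2 [bu1 bu2 bu3] [bv1 bv2 bv3]]] :=
  @peirce_cayley_basis _ c2 H _ _ _ _ _ dimC pq.
have e0' := even_idem_homog e0; have [em em'] := even_idem_main e.
have mulP := grading_mul (main_gradingP C).
(* The middle degree is that of u2 = v3 v1; it makes the sum zero, and v2 = u3 u1 gets the opposite
   degree. *)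
exists b, (fun i => nth 0 [:: g1; - g3 - g1; g3] i); split.
- apply: cayley_adapted_degrees; first by rewrite b1 b2 bu3 bv3.
  rewrite bu1 bu2 bv1 bv2; split=> //.
    by have := mulP _ _ _ _ v30 v11; rewrite add0r.
  by have := mulP _ _ _ _ u30 u11; rewrite add0r.
- by rewrite !big_ord_recl big_ord0 /= addr0 [- g3 - g1 + g3]addrAC addNr sub0r subrr.
- apply: cayley_basis_grading; rewrite ?b1 ?b2 // => i; elim/ord3P: i => /=.
  + by rewrite bu1.
  + by rewrite bu2; apply: (grading_mul gr).
  + by rewrite bu3.
  + by rewrite bv1.
  + by rewrite bv2 opprB opprK addrC; apply: (grading_mul gr).
  + by rewrite bv3.
Qed.

End CanonicalGrading.

(** * Triples of degrees up to sign *)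

Section SignedTriples.
Context {G : zmodType}.
Implicit Types (x y z : G).

Definition pm_eq x y := x = y \/ x = - y.

Lemma pm_eq_sym x y : pm_eq x y -> pm_eq y x.
Proof. by case=> ->; [left | right; rewrite opprK]. Qed.

Lemma pm_eq_trans y x z : pm_eq x y -> pm_eq y z -> pm_eq x z.
Proof.
by case=> ->; case=> ->; rewrite ?opprK; [left|right|right|left].
Qed.

Lemma pm_eq_in4 x y z : x \in [:: y; - y; z; - z] -> pm_eq x y \/ pm_eq x z.
Proof.
by rewrite !inE => /or4P[] /eqP ->;
   [left; left|left; right|right; left|right; right].
Qed.

Lemma pm_eq_in3 x y :
  (forall z, (z \in [:: 0; x; - x]) = (z \in [:: 0; y; - y])) ->
  pm_eq x y.
Proof.
move=> E; have : x \in [:: 0; y; - y] by rewrite -E !inE eqxx orbT.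
rewrite !inE => /or3P[/eqP x0|/eqP->|/eqP->]; [|by left|by right].
have := E y; rewrite !inE eqxx orbT x0 oppr0 !orbb => /eqP ->.
by left.
Qed.

(** If a' and b' both match a, then b matches one of them by the reverse inclusion, and all four
    agree up to sign; the case where both match b is symmetric. *)
Lemma pm_eq_pairs a b a' b' :
  (forall x, (x \in [:: a; - a; b; - b]) = (x \in [:: a'; - a'; b'; - b'])) ->
  pm_eq a' a /\ pm_eq b' b \/ pm_eq a' b /\ pm_eq b' a.
Proof.
move=> E.
have /pm_eq_in4 a'P : a' \in [:: a; - a; b; - b] by rewrite E mem_head.
have /pm_eq_in4 b'P : b' \in [:: a; - a; b; - b] by rewrite E !inE eqxx !orbT.
have /pm_eq_in4 aP : a \in [:: a'; - a'; b'; - b'] by rewrite -E mem_head.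
have /pm_eq_in4 bP : b \in [:: a'; - a'; b'; - b'] by rewrite -E !inE eqxx !orbT.
case: a'P b'P => a'P [] b'P; [left|by left|by right|right]; split=> //.
  case: bP => /pm_eq_sym bP.
    by apply: pm_eq_trans b'P (pm_eq_trans (pm_eq_sym a'P) bP).
  by [].
case: aP => /pm_eq_sym aP; last by [].
by apply: pm_eq_trans b'P (pm_eq_trans (pm_eq_sym a'P) aP).
Qed.

(* If b' = -b, then c' = c forces 2b = 0 and c' = -c forces 2a = 0. *)
Lemma triple_sign_common a b c b' c' : a + b + c = 0 -> a + b' + c' = 0 ->
  pm_eq b' b -> pm_eq c' c ->
  (b' = b /\ c' = c) \/ [/\ a = - a, b' = - b & c' = - c].
Proof.
move=> s0 s0' bb cc; have [b'b|b'b] := eqVneq b' b.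
  left; split=> //; apply: (addrI (a + b')); rewrite s0' b'b s0 //.
case: bb => [bE|bE]; first by rewrite bE eqxx in b'b.
case: cc => cE; last first.
  right; split=> //; apply: (addIr (b' + c')); rewrite addrA s0' bE cE.
  by rewrite -!opprD addrA s0 oppr0.
left; split=> //; apply: (addrI a); apply: (addIr c'); rewrite s0' cE s0 //.
Qed.

(** Up to negating the first triple, a' = a. Then either the triples agree, or a = -a while the
    other two entries change sign, and in that case -1 works for all three. *)
Lemma triple_sign a b c a' b' c' : a + b + c = 0 -> a' + b' + c' = 0 ->
  pm_eq a' a -> pm_eq b' b -> pm_eq c' c ->
  exists eps : int, (eps = 1 \/ eps = -1) /\
    [/\ a' = a *~ eps, b' = b *~ eps & c' = c *~ eps].
Proof.
move=> s0 s0' [] Ea; rewrite {}Ea {a'} in s0' *; move=> bb cc.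
  have [[-> ->]|[aE -> ->]] := triple_sign_common s0 s0' bb cc.
    by exists 1; rewrite !mulr1z; split; [left|split].
  by exists (-1); rewrite !mulrN1z -aE; split; [right|split].
have {s0} s0 : - a + - b + - c = 0 by rewrite -!opprD s0 oppr0.
have bb' : pm_eq b' (- b) by case: bb => ->; [right; rewrite opprK|left].
have cc' : pm_eq c' (- c) by case: cc => ->; [right; rewrite opprK|left].
have [[-> ->]|[aE -> ->]] := triple_sign_common s0 s0' bb' cc'.
  by exists (-1); rewrite !mulrN1z; split; [right|split].
by exists 1; rewrite !mulr1z aE !opprK; split; [left|split].
Qed.

Lemma ord2P (P : 'I_2 -> Prop) : P ord0 -> P ord_max -> forall i, P i.
Proof.
move=> P0 P1 [[|[|//]] lti].
  by rewrite (_ : Ordinal lti = ord0) //; apply: val_inj.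
by rewrite (_ : Ordinal lti = ord_max) //; apply: val_inj.
Qed.

Lemma idx1E : lift ord_max (ord0 : 'I_2) = idx1. Proof. exact: val_inj. Qed.

Lemma triple_equiv_of_supports (gam gam' : 'I_3 -> G) :
  \sum_i gam i = 0 -> \sum_i gam' i = 0 ->
  (forall x, (x \in [:: gam idx1; - gam idx1; gam idx2; - gam idx2]) =
             (x \in [:: gam' idx1; - gam' idx1; gam' idx2; - gam' idx2])) ->
  (forall x, (x \in [:: 0; gam idx3; - gam idx3]) =
             (x \in [:: 0; gam' idx3; - gam' idx3])) ->
  triple_equiv gam gam'.
Proof.
have sumE (f : 'I_3 -> G) : \sum_i f i = f idx1 + f idx2 + f idx3.
  rewrite !big_ord_recl big_ord0 addr0 addrA.
  by congr (f _ + f _ + f _); apply: val_inj.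
rewrite !sumE => s0 s0' /pm_eq_pairs E /pm_eq_in3 /pm_eq_sym cc.
case: E => -[aa bb].
  have [eps [epsP [E1 E2 E3]]] := triple_sign s0 s0' aa bb cc.
  exists 1%g, eps; do 2![split=> //]; elim/ord2P; rewrite perm1 //.
  by rewrite idx1E.
rewrite (addrC (gam idx1)) in s0.
have [eps [epsP [E1 E2 E3]]] := triple_sign s0 s0' aa bb cc.
exists (tperm ord0 ord_max), eps; do 2![split=> //].
by elim/ord2P; rewrite ?tpermL ?tpermR idx1E.
Qed.

End SignedTriples.

(** * Isomorphisms between canonical bases *)

Section Isomorphisms.
Context {F : fieldType}.

Lemma hom_of_bases (U V : vectType F) (X : seq U) (Y : seq V) :
  basis_of {:U} X -> basis_of {:V} Y -> size X = size Y ->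
  exists f : 'Hom(U, V), [/\ map f X = Y, lker f = 0%VS & limg f = fullv].
Proof.
move=> bX bY sXY; have [f Ef] := linear_of_free X Y.
have fX : map (linfun f) X = Y.
  by rewrite -(Ef (basis_free bX)) //; apply: eq_map => x; rewrite lfunE.
have im : limg (linfun f) = fullv.
  by rewrite -(span_basis bX) limg_span fX (span_basis bY).
exists (linfun f); split=> //; apply/eqP; rewrite -dimv_eq0.
have := limg_ker_dim (linfun f) fullv; rewrite im capfv.
rewrite (size_basis (X := in_tuple X) bX) (size_basis (X := in_tuple Y) bY) /=.
by rewrite sXY -[RHS]add0n => /eqP; rewrite eqn_add2r => /eqP->.
Qed.

Lemma lfun_opp (U V : vectType F) (f : 'Hom(U, V)) x : f (- x) = - f x.
Proof. exact: linearN. Qed.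

Lemma lfun_natmul (U V : vectType F) (f : 'Hom(U, V)) x n :
  f (x *+ n) = f x *+ n.
Proof. exact: linearMn. Qed.

Lemma amul_hom_on_span (A B : algebra F) (f : 'Hom(A, B)) (s : seq A) :
  <<s>>%VS = fullv ->
  (forall x y, x \in s -> y \in s -> f (amul x y) = amul (f x) (f y)) ->
  forall x y, f (amul x y) = amul (f x) (f y).
Proof.
move=> sT fs; have sP (x : A) : x \in <<s>>%VS by rewrite sT memvf.
have fm x : x \in s -> forall y, f (amul x y) = amul (f x) (f y).
  move=> xs y; apply: (@linear_eq_on_span _ _ _ (fun y => f (amul x y))
    (fun y => amul (f x) (f y)) s) (sP y) => [a z w|a z w|w ws].
  - by rewrite amulDr amulZr linearP.
  - by rewrite linearP amulDr amulZr.
  - exact: fs.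
move=> x y; apply: (@linear_eq_on_span _ _ _ (fun x => f (amul x y))
    (fun x => amul (f x) (f y)) s) (sP x) => [a z w|a z w|w ws].
- by rewrite amulDl amulZl linearP.
- by rewrite linearP amulDl amulZl.
- exact: fm.
Qed.

Lemma limg_span_degrees (A B : algebra F) (G : zmodType) (f : 'Hom(A, B))
    (s : seq (A * G)) (g : G) :
  (f @: span_degrees s g)%VS = span_degrees [seq (f p.1, p.2) | p <- s] g.
Proof.
rewrite limg_span /span_degrees; congr (<<_>>%VS).
by elim: s => //= -[x h] s IH /=; case: eqP => _ /=; rewrite IH.
Qed.

(** Gradings are families of subspaces known to agree only componentwise; this transports
    isomorphisms without functional extensionality. *)
Lemma grading_iso_eq (A B : superalgebra F) (G : zmodType)
    (Gam Gam' : G -> {vspace A}) (Del Del' : G -> {vspace B}) :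
  (forall g, Gam g = Gam' g) -> (forall g, Del g = Del' g) ->
  grading_iso Gam Del -> grading_iso Gam' Del'.
Proof.
move=> EG ED [f [fi fG]]; exists f; split=> // g.
by rewrite -EG -ED.
Qed.

(** The supports of the even and odd parts are thus invariants of the grading, and they are the ones
    that separate the canonical gradings. *)
Lemma grading_iso_cap (A B : superalgebra F) (G : zmodType)
    (Gam : G -> {vspace A}) (Del : G -> {vspace B}) :
  grading_iso Gam Del -> forall g,
  ((Gam g :&: even_part A == 0) = (Del g :&: even_part B == 0))%VS /\
  ((Gam g :&: odd_part A == 0) = (Del g :&: odd_part B == 0))%VS.
Proof.
move=> [f [[/eqP fi _ _ fe fo] fG]] g.
have im0 (V : {vspace A}) : ((f @: V)%VS == 0%VS) = (V == 0%VS).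
  by rewrite -!dimv_eq0 limg_dim_eq // (eqP fi) capv0.
by rewrite -fG -fe -fo -!lker0_img_cap // !im0.
Qed.

Lemma quaternion_basis_iso (A B : superalgebra F) (b : quaternion_basis A)
    (b' : quaternion_basis B) :
  quaternion_adapted b -> quaternion_adapted b' ->
  exists f : 'Hom(A, B), is_superalgebra_iso f /\
    [/\ f (qe1 b) = qe1 b', f (qe2 b) = qe2 b', f (qu1 b) = qu1 b'
      & f (qv1 b) = qv1 b'].
Proof.
move=> [be bo] [be' bo'].
have [|f [/= [f1 f2 f3 f4] kf imf]] :=
  hom_of_bases (quaternion_basisP b) (quaternion_basisP b'); first by [].
exists f; split=> //; split=> //.
- apply: (amul_hom_on_span (span_basis (quaternion_basisP b))) => x y.
  have [ee1 ee2 ee3 ee4] := quaternion_ee b.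
  have [eu1 eu2 eu3 eu4] := quaternion_eu b.
  have [ev1 ev2 ev3 ev4] := quaternion_ev b.
  have [uv1 uv2 uv3 uv4] := quaternion_uv b.
  have [ee1' ee2' ee3' ee4'] := quaternion_ee b'.
  have [eu1' eu2' eu3' eu4'] := quaternion_eu b'.
  have [ev1' ev2' ev3' ev4'] := quaternion_ev b'.
  have [uv1' uv2' uv3' uv4'] := quaternion_uv b'.
  by rewrite !inE => /or4P[] /eqP-> /or4P[] /eqP->;
    rewrite ?f1 ?f2 ?f3 ?f4
      ?ee1 ?ee2 ?ee3 ?ee4 ?eu1 ?eu2 ?eu3 ?eu4
      ?ev1 ?ev2 ?ev3 ?ev4 ?uv1 ?uv2 ?uv3 ?uv4
      ?ee1' ?ee2' ?ee3' ?ee4' ?eu1' ?eu2' ?eu3' ?eu4' ?ev1' ?ev2' ?ev3' ?ev4'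
      ?uv1' ?uv2' ?uv3' ?uv4' ?lfun_opp ?linear0 ?f1 ?f2 ?f3 ?f4.
- by rewrite be be' limg_span /= f1 f2.
- by rewrite bo bo' limg_span /= f3 f4.
Qed.

Lemma ordS3_cases (i j : 'I_3) : [\/ j = i, j = ordS i | i = ordS j].
Proof.
elim/ord3P: i; elim/ord3P: j; rewrite ?ordS_idx;
  by [constructor 1 | constructor 2 | constructor 3].
Qed.

Lemma cayley_rules (A : algebra F) (b : cayley_basis A) :
  (amul (ce1 b) (ce1 b) = ce1 b) * (amul (ce2 b) (ce2 b) = ce2 b) *
  (amul (ce1 b) (ce2 b) = 0) * (amul (ce2 b) (ce1 b) = 0) *
  (forall i, amul (ce1 b) (cu b i) = cu b i) *
  (forall i, amul (cu b i) (ce2 b) = cu b i) *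
  (forall i, amul (ce2 b) (cu b i) = 0) *
  (forall i, amul (cu b i) (ce1 b) = 0) *
  (forall i, amul (ce2 b) (cv b i) = cv b i) *
  (forall i, amul (cv b i) (ce1 b) = cv b i) *
  (forall i, amul (ce1 b) (cv b i) = 0) *
  (forall i, amul (cv b i) (ce2 b) = 0) *
  (forall i, amul (cu b i) (cu b (ordS i)) = cv b (ordS (ordS i))) *
  (forall i, amul (cu b (ordS i)) (cu b i) = - cv b (ordS (ordS i))) *
  (forall i, amul (cu b i) (cu b i) = 0) *
  (forall i, amul (cv b i) (cv b (ordS i)) = cu b (ordS (ordS i))) *
  (forall i, amul (cv b (ordS i)) (cv b i) = - cu b (ordS (ordS i))) *
  (forall i, amul (cv b i) (cv b i) = 0) *
  (forall i j, amul (cu b i) (cv b j) = - (ce1 b *+ (i == j))) *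
  (forall i j, amul (cv b i) (cu b j) = - (ce2 b *+ (i == j))).
Proof.
do !split; first [by case: (cayley_ee b) | exact: cayley_uv
  | exact: cayley_vu | move=> i; first
  [ by case: (cayley_eu b i) | by case: (cayley_ev b i)
  | by case: (cayley_uu b i) | by case: (cayley_vv b i)]].
Qed.

Lemma cayley_basis_iso (A B : superalgebra F) (b : cayley_basis A)
    (b' : cayley_basis B) :
  cayley_adapted b -> cayley_adapted b' ->
  exists f : 'Hom(A, B), is_superalgebra_iso f /\
    [/\ f (ce1 b) = ce1 b', f (ce2 b) = ce2 b',
        forall i, f (cu b i) = cu b' i & forall i, f (cv b i) = cv b' i].
Proof.
move=> [be bo] [be' bo'].
have [|f [fX kf imf]] :=
  hom_of_bases (cayley_basisP b) (cayley_basisP b').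
  by rewrite !codom_ord3.
rewrite !codom_ord3 /= in fX; case: fX => f1 f2 fu1 fu2 fu3 fv1 fv2 fv3.
have fu i : f (cu b i) = cu b' i by elim/ord3P: i.
have fv i : f (cv b i) = cv b' i by elim/ord3P: i.
exists f; split=> //; split=> //.
- apply: (amul_hom_on_span (span_basis (cayley_basisP b))).
  have span_ind (P : A -> Prop) : P (ce1 b) -> P (ce2 b) ->
      (forall i, P (cu b i)) -> (forall i, P (cv b i)) ->
      forall x, x \in [:: ce1 b; ce2 b] ++ codom (cu b) ++ codom (cv b) -> P x.
    move=> P1 P2 Pu Pv x; rewrite !mem_cat !inE -orbA.
    by move=> /or4P[/eqP->|/eqP->|/codomP[i ->]|/codomP[i ->]].
  move=> x y xs ys; move: x xs y ys; apply: (span_ind) => [|| i | i];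
    apply: (span_ind) => [|| j | j]; rewrite ?f1 ?f2 ?fu ?fv.
  all: try by rewrite !cayley_rules ?linear0 ?f1 ?f2 ?fu ?fv.
  all: try by rewrite !cayley_rules lfun_opp lfun_natmul ?f1 ?f2.
  + case: (ordS3_cases i j) => ->;
      by rewrite !cayley_rules ?linear0 ?lfun_opp ?fv.
  + case: (ordS3_cases i j) => ->;
      by rewrite !cayley_rules ?linear0 ?lfun_opp ?fu.
- by rewrite be be' limg_span /= f1 f2 fu fv.
- by rewrite bo bo' limg_span /= !fu !fv.
Qed.

End Isomorphisms.

(** * Symmetries and supports of the canonical gradings *)

Section GammaIsomorphisms.
Context {F : fieldType}.

Lemma eq_span_degrees (A : algebra F) (G : zmodType) (s s' : seq (A * G)) :
  s =i s' -> forall g, span_degrees s g = span_degrees s' g.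
Proof.
move=> ss' g; apply: eq_span; apply: eq_mem_map => p.
by rewrite !mem_filter ss'.
Qed.

Lemma Gamma8E (A : algebra F) (b : cayley_basis A) (G : zmodType)
    (gam : 'I_3 -> G) :
  Gamma8 b gam = span_degrees
    [:: (ce1 b, 0); (ce2 b, 0);
        (cu b idx1, gam idx1); (cu b idx2, gam idx2); (cu b idx3, gam idx3);
        (cv b idx1, - gam idx1); (cv b idx2, - gam idx2);
        (cv b idx3, - gam idx3)].
Proof. by rewrite /Gamma8 enum_ord3. Qed.

Lemma quaternion_adapted_iso (A B : superalgebra F) (b : quaternion_basis A)
    (b' : quaternion_basis B) (G : zmodType) (g : G) :
  quaternion_adapted b -> quaternion_adapted b' ->
  grading_iso (Gamma4 b g) (Gamma4 b' g).
Proof.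
move=> ab ab'; have [f [fi [f1 f2 f3 f4]]] := quaternion_basis_iso ab ab'.
by exists f; split=> // h; rewrite limg_span_degrees /= f1 f2 f3 f4.
Qed.

Lemma cayley_adapted_iso (A B : superalgebra F) (b : cayley_basis A)
    (b' : cayley_basis B) (G : zmodType) (gam : 'I_3 -> G) :
  cayley_adapted b -> cayley_adapted b' ->
  grading_iso (Gamma8 b gam) (Gamma8 b' gam).
Proof.
move=> ab ab'; have [f [fi [f1 f2 fu fv]]] := cayley_basis_iso ab ab'.
exists f; split=> // h.
by rewrite !Gamma8E limg_span_degrees /= f1 f2 !fu !fv.
Qed.

Lemma quaternion_basis_opp (A : algebra F) (b : quaternion_basis A) :
  exists b' : quaternion_basis A,
    [/\ qe1 b' = qe2 b, qe2 b' = qe1 b, qu1 b' = qv1 b & qv1 b' = qu1 b].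
Proof.
have bP : basis_of {:A} [:: qe2 b; qe1 b; qv1 b; qu1 b].
  rewrite -(perm_basis _ (_ : perm_eq [:: qe1 b; qe2 b; qu1 b; qv1 b] _)).
    exact: quaternion_basisP.
  by apply/seq.permP => p /=; ring.
have ee : [/\ amul (qe2 b) (qe2 b) = qe2 b, amul (qe1 b) (qe1 b) = qe1 b,
    amul (qe2 b) (qe1 b) = 0 & amul (qe1 b) (qe2 b) = 0].
  by case: (quaternion_ee b).
have uv : [/\ amul (qv1 b) (qv1 b) = 0, amul (qu1 b) (qu1 b) = 0,
    amul (qv1 b) (qu1 b) = - qe2 b & amul (qu1 b) (qv1 b) = - qe1 b].
  by case: (quaternion_uv b).
by exists (QuaternionBasis bP ee (quaternion_ev b) (quaternion_eu b) uv).
Qed.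

(** This symmetry of the table negates all degrees and so realises the sign -1 of [triple_equiv]. *)
Lemma cayley_basis_opp (A : algebra F) (b : cayley_basis A) :
  exists b' : cayley_basis A,
    [/\ ce1 b' = ce2 b, ce2 b' = ce1 b, cu b' = cv b & cv b' = cu b].
Proof.
have bP : basis_of {:A} ([:: ce2 b; ce1 b] ++ codom (cv b) ++ codom (cu b)).
  rewrite -(perm_basis _ (_ :
    perm_eq ([:: ce1 b; ce2 b] ++ codom (cu b) ++ codom (cv b)) _)).
    exact: cayley_basisP.
  by apply/seq.permP => p; rewrite /= !count_cat; ring.
have ee : [/\ amul (ce2 b) (ce2 b) = ce2 b, amul (ce1 b) (ce1 b) = ce1 b,
    amul (ce2 b) (ce1 b) = 0 & amul (ce1 b) (ce2 b) = 0].
  by case: (cayley_ee b).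
by exists (CayleyBasis bP ee (cayley_ev b) (cayley_eu b) (cayley_vv b)
  (cayley_uu b) (cayley_vu b) (cayley_uv b)).
Qed.

Definition swap12 (i : 'I_3) : 'I_3 :=
  if i == idx1 then idx2 else if i == idx2 then idx1 else idx3.

Lemma swap12K : involutive swap12.
Proof. by elim/ord3P. Qed.

(** A transposition reverses the cyclic order, so [ordS] passes to the other side; this rewrites the
    swapped products into the known ones with their factors exchanged. *)
Lemma swap12_ordS i : swap12 i = ordS (swap12 (ordS i)).
Proof. by elim/ord3P: i; apply: val_inj. Qed.

Lemma swap12_ordS2 i : swap12 (ordS (ordS i)) = ordS (ordS (swap12 (ordS i))).
Proof. by elim/ord3P: i; apply: val_inj. Qed.

(* Exchanging u_1 and u_2 negates all products u_i u_{i+1}, which is harmless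
   here. *)
Lemma cayley_basis_swap (A : algebra F) (b : cayley_basis A) :
  2%N \in [pchar F] ->
  exists b' : cayley_basis A,
    [/\ ce1 b' = ce1 b, ce2 b' = ce2 b, cu b' = cu b \o swap12
      & cv b' = cv b \o swap12].
Proof.
move=> c2.
have bP : basis_of {:A}
    ([:: ce1 b; ce2 b] ++ codom (cu b \o swap12) ++ codom (cv b \o swap12)).
  rewrite -(perm_basis _ (_ :
    perm_eq ([:: ce1 b; ce2 b] ++ codom (cu b) ++ codom (cv b)) _)).
    exact: cayley_basisP.
  by rewrite !codom_ord3; apply/seq.permP => p /=; ring.
have uu i : [/\ amul (cu b (swap12 i)) (cu b (swap12 (ordS i)))
                    = cv b (swap12 (ordS (ordS i))),
    amul (cu b (swap12 (ordS i))) (cu b (swap12 i))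
      = - cv b (swap12 (ordS (ordS i)))
    & amul (cu b (swap12 i)) (cu b (swap12 i)) = 0].
  rewrite (swap12_ordS i) swap12_ordS2 !cayley_rules.
  by rewrite !(oppv_char2 _ c2).
have vv i : [/\ amul (cv b (swap12 i)) (cv b (swap12 (ordS i)))
                    = cu b (swap12 (ordS (ordS i))),
    amul (cv b (swap12 (ordS i))) (cv b (swap12 i))
      = - cu b (swap12 (ordS (ordS i)))
    & amul (cv b (swap12 i)) (cv b (swap12 i)) = 0].
  rewrite (swap12_ordS i) swap12_ordS2 !cayley_rules.
  by rewrite !(oppv_char2 _ c2).
have uv i j : amul (cu b (swap12 i)) (cv b (swap12 j)) = - (ce1 b *+ (i == j)).
  by rewrite cayley_uv (inj_eq (can_inj swap12K)).
have vu i j : amul (cv b (swap12 i)) (cu b (swap12 j)) = - (ce2 b *+ (i == j)).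
  by rewrite cayley_vu (inj_eq (can_inj swap12K)).
by exists (CayleyBasis bP (cayley_ee b) (fun i => cayley_eu b (swap12 i))
  (fun i => cayley_ev b (swap12 i)) uu vv uv vu).
Qed.

Section Supports.
Context {A : superalgebra F} {G : zmodType}.

Lemma span_degrees_cap_eq0 (s : seq (A * G)) (U V : {vspace A}) (g : G) :
  (forall x, x \in U -> x \in V -> x = 0) ->
  (forall p, p \in s -> p.2 = g -> p.1 \in U) ->
  (span_degrees s g :&: V)%VS = 0%VS.
Proof.
move=> UV sU; apply/eqP; rewrite -subv0; apply/subvP => x.
rewrite memv_cap memv0 => /andP[xs xV]; apply/eqP/UV => //; move: x xs {xV}.
apply/subvP/span_subvP => y /mapP[p]; rewrite mem_filter => /andP[/eqP pg ps] ->.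
exact: sU.
Qed.

Lemma span_degrees_cap_neq0 (s : seq (A * G)) (V : {vspace A}) (x : A) (g : G) :
  (x, g) \in s -> x \in V -> x != 0 -> (span_degrees s g :&: V)%VS != 0%VS.
Proof.
move=> xs xV x0; apply: contraNneq x0 => sV0.
rewrite -memv0 -sV0 memv_cap xV andbT; apply: memv_span.
by apply/mapP; exists (x, g); rewrite // mem_filter eqxx.
Qed.

Lemma Gamma4_odd_support (b : quaternion_basis A) (g h : G) :
  quaternion_adapted b ->
  ((Gamma4 b g h :&: odd_part A)%VS != 0%VS) = (h \in [:: g; - g]).
Proof.
move=> [be bo].
have xe x : x \in [:: qe1 b; qe2 b] -> x \in even_part A by rewrite be; apply: memv_span.
have xo x : x \in [:: qu1 b; qv1 b] -> x \in odd_part A by rewrite bo; apply: memv_span.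
have x0 x : x \in [:: qe1 b; qe2 b; qu1 b; qv1 b] -> x != 0.
  by move=> xb; apply: (free_not0 (basis_free (quaternion_basisP b)) xb).
apply/idP/idP => [|].
  apply: contraR; rewrite !inE => /norP[hg hg']; rewrite ?negbK.
  apply/eqP; apply: (span_degrees_cap_eq0 (@even_odd_disjoint _ A)) => p.
  rewrite !inE => /or4P[]/eqP-> /= ph; rewrite ?ph ?eqxx in hg hg' *;
    by rewrite ?xe // !inE eqxx ?orbT.
by rewrite !inE => /orP[]/eqP->;
  [apply: (@span_degrees_cap_neq0 _ _ (qu1 b))
  |apply: (@span_degrees_cap_neq0 _ _ (qv1 b))]; rewrite ?xo ?x0 // !inE eqxx ?orbT.
Qed.

Lemma cayley_basis_neq0 (b : cayley_basis A) :
  (forall i, cu b i != 0) * (forall i, cv b i != 0) * (ce1 b != 0).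
Proof.
have x0 x : x \in [:: ce1 b; ce2 b] ++ codom (cu b) ++ codom (cv b) -> x != 0.
  by move=> xb; apply: (free_not0 (basis_free (cayley_basisP b)) xb).
by split; [split=> i|]; apply: x0; rewrite !mem_cat ?codom_f ?orbT // mem_head.
Qed.

Lemma cayley_adapted_even (b : cayley_basis A) : cayley_adapted b ->
  [/\ ce1 b \in even_part A, ce2 b \in even_part A,
      cu b idx3 \in even_part A & cv b idx3 \in even_part A].
Proof.
by case=> -> _; split; apply: memv_span; rewrite !inE eqxx ?orbT.
Qed.

Lemma cayley_adapted_odd (b : cayley_basis A) : cayley_adapted b ->
  [/\ cu b idx1 \in odd_part A, cu b idx2 \in odd_part A,
      cv b idx1 \in odd_part A & cv b idx2 \in odd_part A].
Proof.
by case=> _ ->; split; apply: memv_span; rewrite !inE eqxx ?orbT.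
Qed.

Lemma Gamma8_odd_support (b : cayley_basis A) (gam : 'I_3 -> G) (h : G) :
  cayley_adapted b ->
  ((Gamma8 b gam h :&: odd_part A)%VS != 0%VS) =
  (h \in [:: gam idx1; - gam idx1; gam idx2; - gam idx2]).
Proof.
move=> ab; have [e1 e2 u3 v3] := cayley_adapted_even ab.
have [u1 u2 v1 v2] := cayley_adapted_odd ab; rewrite Gamma8E.
apply/idP/idP => [|].
  apply: contraR => hg; rewrite ?negbK; apply/eqP.
  apply: (span_degrees_cap_eq0 (@even_odd_disjoint _ A)) => p ps ph; move: ps hg.
  by rewrite -ph !inE => /or4P[||| /orP[|/or4P[]]] /eqP-> /=;
    rewrite ?eqxx ?orbT.
by rewrite !inE => /or4P[]/eqP->;
  [apply: (@span_degrees_cap_neq0 _ _ (cu b idx1))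
  |apply: (@span_degrees_cap_neq0 _ _ (cv b idx1))
  |apply: (@span_degrees_cap_neq0 _ _ (cu b idx2))
  |apply: (@span_degrees_cap_neq0 _ _ (cv b idx2))];
  rewrite ?cayley_basis_neq0 // !inE eqxx ?orbT.
Qed.

Lemma Gamma8_even_support (b : cayley_basis A) (gam : 'I_3 -> G) (h : G) :
  cayley_adapted b ->
  ((Gamma8 b gam h :&: even_part A)%VS != 0%VS) =
  (h \in [:: 0; gam idx3; - gam idx3]).
Proof.
move=> ab; have [e1 e2 u3 v3] := cayley_adapted_even ab.
have [u1 u2 v1 v2] := cayley_adapted_odd ab; rewrite Gamma8E.
apply/idP/idP => [|].
  apply: contraR => hg; rewrite ?negbK; apply/eqP.
  apply: (@span_degrees_cap_eq0 _ (odd_part A)) => [x xo xe|p ps ph].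
    exact: even_odd_disjoint xe xo.
  move: ps hg.
  by rewrite -ph !inE => /or4P[||| /orP[|/or4P[]]] /eqP-> /=;
    rewrite ?eqxx ?orbT.
by rewrite !inE => /or3P[]/eqP->;
  [apply: (@span_degrees_cap_neq0 _ _ (ce1 b))
  |apply: (@span_degrees_cap_neq0 _ _ (cu b idx3))
  |apply: (@span_degrees_cap_neq0 _ _ (cv b idx3))];
  rewrite ?cayley_basis_neq0 // !inE eqxx ?orbT.
Qed.

End Supports.

End GammaIsomorphisms.

Section GammaEquivalences.
Context {F : fieldType} {C : superalgebra F} {G : zmodType}.

Lemma Gamma4_opp (b : quaternion_basis C) : quaternion_adapted b ->
  exists b' : quaternion_basis C, quaternion_adapted b' /\
    forall (g h : G), Gamma4 b' g h = Gamma4 b (- g) h.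
Proof.
case=> be bo; have [b' [E1 E2 E3 E4]] := quaternion_basis_opp b.
exists b'; split=> [|g].
  by rewrite /quaternion_adapted be bo E1 E2 E3 E4;
    split; apply: eq_span => x; rewrite !inE orbC.
apply: eq_span_degrees => p; rewrite E1 E2 E3 E4 opprK !inE.
by do 4!case: (p == _).
Qed.

Lemma eq_Gamma8 (b : cayley_basis C) (gam gam' : 'I_3 -> G) :
  gam =1 gam' -> forall h, Gamma8 b gam h = Gamma8 b gam' h.
Proof. by move=> E h; rewrite !Gamma8E !E. Qed.

Lemma Gamma8_opp (b : cayley_basis C) : cayley_adapted b ->
  exists b' : cayley_basis C, cayley_adapted b' /\
    forall (gam : 'I_3 -> G) h,
      Gamma8 b' gam h = Gamma8 b (fun i => - gam i) h.
Proof.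
case=> be bo; have [b' [E1 E2 E3 E4]] := cayley_basis_opp b.
exists b'; split=> [|gam h].
  rewrite /cayley_adapted be bo E1 E2 E3 E4.
  by split; apply: eq_span => x; rewrite !inE; do 4!case: (x == _).
rewrite !Gamma8E; apply: eq_span_degrees => p.
by rewrite E1 E2 E3 E4 !opprK !inE; do 8!case: (p == _).
Qed.

Lemma Gamma8_swap (b : cayley_basis C) :
  2%N \in [pchar F] -> cayley_adapted b ->
  exists b' : cayley_basis C, cayley_adapted b' /\
    forall (gam : 'I_3 -> G) h, Gamma8 b' gam h = Gamma8 b (gam \o swap12) h.
Proof.
move=> c2 [be bo]; have [b' [E1 E2 E3 E4]] := cayley_basis_swap b c2.
exists b'; split=> [|gam h].
  rewrite /cayley_adapted be bo E1 E2 E3 E4.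
  by split; apply: eq_span => x; rewrite !inE /=; do 4!case: (x == _).
rewrite !Gamma8E; apply: eq_span_degrees => p.
by rewrite E1 E2 E3 E4 !inE /=; do 8!case: (p == _).
Qed.

Lemma perm_I2 (sigma : 'S_2) :
  (sigma ord0 = ord0 /\ sigma ord_max = ord_max) \/
  (sigma ord0 = ord_max /\ sigma ord_max = ord0).
Proof.
have : sigma ord0 != sigma ord_max by rewrite (inj_eq perm_inj).
elim/ord2P: (sigma ord0); elim/ord2P: (sigma ord_max);
  by rewrite ?eqxx // => _; by [left | right].
Qed.

(** Permutation and sign are moved from the triple to the basis: b' is replaced by adapted bases
    until the degrees are those of [gam], and two adapted bases carrying the same triple are matched
    by an isomorphism. *)
Lemma triple_equiv_iso (b b' : cayley_basis C) (gam gam' : 'I_3 -> G) :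
  2%N \in [pchar F] -> cayley_adapted b -> cayley_adapted b' ->
  triple_equiv gam gam' -> grading_iso (Gamma8 b gam) (Gamma8 b' gam').
Proof.
move=> c2 ab ab' [sigma [eps [epsP [E3 E12]]]].
have E1 := E12 ord0; have E2 := E12 ord_max; rewrite !idx1E in E1.
have [b1 [ab1 Eb1]] : exists b1 : cayley_basis C, cayley_adapted b1 /\
    forall h, Gamma8 b1 (fun i => gam i *~ eps) h = Gamma8 b' gam' h.
  case: (perm_I2 sigma) => -[s0 s1]; rewrite s0 ?idx1E in E1; rewrite s1 ?idx1E in E2.
    exists b'; split=> // h; apply: eq_Gamma8; apply: ord3P; exact: esym.
  have [b1 [ab1 Eb1]] := Gamma8_swap c2 ab'; exists b1; split=> // h.
  by rewrite Eb1; apply: eq_Gamma8; apply: ord3P; apply: esym.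
have [b2 [ab2 Eb2]] : exists b2 : cayley_basis C, cayley_adapted b2 /\
    forall h, Gamma8 b2 gam h = Gamma8 b1 (fun i => gam i *~ eps) h.
  case: epsP => ->.
    by exists b1; split=> // h; apply: eq_Gamma8 => i; rewrite mulr1z.
  have [b2 [ab2 Eb2]] := Gamma8_opp ab1; exists b2; split=> // h.
apply: (grading_iso_eq _ _ (cayley_adapted_iso gam ab ab2)) => // h.
by rewrite Eb2 Eb1.
Qed.

Lemma iso_triple_equiv (b b' : cayley_basis C) (gam gam' : 'I_3 -> G) :
  cayley_adapted b -> cayley_adapted b' ->
  \sum_i gam i = 0 -> \sum_i gam' i = 0 ->
  grading_iso (Gamma8 b gam) (Gamma8 b' gam') -> triple_equiv gam gam'.
Proof.
move=> ab ab' s0 s0' /grading_iso_cap E.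
apply: triple_equiv_of_supports => // x.
  by rewrite -(Gamma8_odd_support _ _ ab) -(Gamma8_odd_support _ _ ab') (E x).2.
by rewrite -(Gamma8_even_support _ _ ab) -(Gamma8_even_support _ _ ab') (E x).1.
Qed.

Lemma Gamma4_iso_iff (b b' : quaternion_basis C) (g h : G) :
  quaternion_adapted b -> quaternion_adapted b' ->
  grading_iso (Gamma4 b g) (Gamma4 b' h) <-> g = h \/ g = - h.
Proof.
move=> ab ab'; split=> [/grading_iso_cap E|].
  have : g \in [:: h; - h].
    by rewrite -(Gamma4_odd_support _ _ ab') -(E g).2 (Gamma4_odd_support _ _ ab) mem_head.
  by rewrite !inE => /orP[]/eqP; [left|right].
case=> ->; first exact: quaternion_adapted_iso.
have [b2 [ab2 Eb2]] := Gamma4_opp ab'.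
apply: (grading_iso_eq _ _ (quaternion_adapted_iso (- h) ab ab2)) => // x.
by rewrite Eb2 opprK.
Qed.

End GammaEquivalences.

Theorem theorem21 (F : closedFieldType) (char2 : 2%N \in [pchar F])
    (Q : hurwitz F) (dimQ : \dim {:Q} = 2%N \/ \dim {:Q} = 4%N)
    (alpha : F) (alpha_neq0 : alpha != 0) (G : zmodType) :
  let C := CD Q alpha in
  (\dim {:C} = 4%N ->
     (exists b : quaternion_basis C, quaternion_adapted b)
     /\ (forall b : quaternion_basis C, quaternion_adapted b ->
         forall Gam : G -> {vspace C}, is_super_grading Gam ->
         exists g : G, grading_iso Gam (Gamma4 b g))
     /\ (forall b b' : quaternion_basis C,
         quaternion_adapted b -> quaternion_adapted b' ->
         forall g h : G,
         grading_iso (Gamma4 b g) (Gamma4 b' h) <-> g = h \/ g = - h))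
  /\
  (\dim {:C} = 8%N ->
     (exists b : cayley_basis C, cayley_adapted b)
     /\ (forall b : cayley_basis C, cayley_adapted b ->
         forall Gam : G -> {vspace C}, is_super_grading Gam ->
         exists gam : 'I_3 -> G,
           \sum_i gam i = 0 /\ grading_iso Gam (Gamma8 b gam))
     /\ (forall b b' : cayley_basis C,
         cayley_adapted b -> cayley_adapted b' ->
         forall gam gam' : 'I_3 -> G,
         \sum_i gam i = 0 -> \sum_i gam' i = 0 ->
         grading_iso (Gamma8 b gam) (Gamma8 b' gam')
         <-> triple_equiv gam gam')).
Proof.
have mainP := CD_main_super_grading Q alpha.
split=> dimC.
  split; [|split] => [|b ab Gam sg|b b' ab ab' g h].
  - by have [b [_ [ab _]]] := exists_Gamma4 char2 dimQ alpha_neq0 mainP dimC; exists b.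
  - have [b' [g [ab' E]]] := exists_Gamma4 char2 dimQ alpha_neq0 sg dimC.
    (* The basis found depends on the grading; matching adapted bases carries the result to the
       prescribed one. *)
    by exists g; apply: (grading_iso_eq _ _ (quaternion_adapted_iso g ab' ab)).
  - exact: Gamma4_iso_iff.
split; [|split] => [|b ab Gam sg|b b' ab ab' gam gam' s0 s0'].
- by have [b [_ [ab _ _]]] := exists_Gamma8 char2 dimQ alpha_neq0 mainP dimC; exists b.
- have [b' [gam [ab' s0 E]]] := exists_Gamma8 char2 dimQ alpha_neq0 sg dimC.
  exists gam; split=> //.
  by apply: (grading_iso_eq _ _ (cayley_adapted_iso gam ab' ab)).
- by split; [exact: iso_triple_equiv | exact: triple_equiv_iso].
Qed.
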